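(* Fix $T>s$ in $I$, assume conditions (i)--(v) and (a)--(e) of the lists in the context, and fix $\boldsymbol f\in C_b(\mathbb R^d;\mathbb R^m)$. Then: (i) the function $I\times(0,\infty)\times\mathbb R^d\ni(t,\tau,x)\mapsto(\boldsymbol T_t(\tau)\boldsymbol f)(x)$ is continuous; (ii) for every bounded sequence $(\boldsymbol f_n)\subset C_b(\mathbb R^d;\mathbb R^m)$ which converges to $\boldsymbol f$ locally uniformly on $\mathbb R^d$, the function $(t,\tau,x)\mapsto(\boldsymbol T_t(\tau)\boldsymbol f_n)(x)$ converges to the function $(t,\tau,x)\mapsto(\boldsymbol T_t(\tau)\boldsymbol f)(x)$ locally uniformly in $I\times(0,\infty)\times\mathbb R^d$ as $n\to\infty$.
   Context: Let $d\ge1$, $m\ge 2$ and let $I$ be a right halfline (possibly $I=\mathbb R$). For smooth $\boldsymbol\zeta:\mathbb R^d\to\mathbb R^m$, $k=1,\dots,m$, $(t,x)\in I\times\mathbb R^d$, set $$(\boldsymbol{\mathcal A}(t)\boldsymbol\zeta(x))_k=\sum_{i,j=1}^dq_{ij}^k(t,x)D_{ij}\zeta_k(x)+\sum_{j=1}^db^k_j(t,x)D_j\zeta_k(x)+\sum_{h=1}^mc_{kh}(t,x)\zeta_h(x),$$ with $Q^k=(q^k_{ij})$, $\boldsymbol b^k=(b^k_j)$, $C=(c_{kh})$. Let $\boldsymbol{\mathcal A}^P(t)$ be the operator obtained by replacing $C$ by $C^P=(c^P_{kh})$, where $c^P_{kk}=c_{kk}$ and $c^P_{kh}=|c_{kh}|$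 for $h\ne k$. Set $M_k(t,x):=\sum_{j=1}^mc^P_{kj}(t,x)$. Conditions (i)--(v): (i) the coefficients $q^k_{ij}=q^k_{ji}$, $b^k_j$, $c_{kh}$ belong to $C^{\alpha/2,\alpha}_{\rm loc}(I\times\mathbb R^d)$ for some $\alpha\in(0,1)$; (ii) for every bounded interval $J\subset I$ and every $k$, the infimum over $J\times\mathbb R^d$ of the minimum eigenvalue $\mu^k(t,x)$ of $Q^k(t,x)$ is positive; (iii) for every bounded interval $J\subset I$ there exist a componentwise positive function $\boldsymbol\varphi_J\in C^2(\mathbb R^d;\mathbb R^m)$, blowing up componentwise as $|x|\to\infty$, and a constant $\lambda_J>0$ such that $\boldsymbol{\mathcal A}^P\boldsymbol\varphi_J\le\lambda_J\boldsymbol\varphi_J$ (componentwise) in $J\times\mathbb R^d$; (iv) there is no nontrivial (i.e. nonempty and proper) set $K\subset\{1,\dots,m\}$ such that $c^P_{ij}$ vanishes identically on $I\times\mathbb R^d$ for every $i\in K$ and $j\notin K$; (v) for every bounded interval $J\subset I$, the sum of the elements of each row of $C^P$ is bounded from above on $J\times\mathbb R^d$. Conditions (a)--(e), with $T>s$ fixed in $I$: (a) the coefficients of $\boldsymbol{\mathcal A}$ belong to $C^{\alpha/2,3+\alpha}_{\rm loc}(I\times\mathbb R^d)$ (spatial derivatives up to order 3 are in $C^{\alpha/2,\alpha}_{\rm loc}$); (b) for every $k=1,\dots,m$ there is a function $r^k:[s,T]\times\mathbb R^d\to\mathbb R$ such that $\langle(J_x\boldsymbol b^k)\xi,\xi\rangle\le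 r^k|\xi|^2$ on $[s,T]\times\mathbb R^d$ for every $\xi\in\mathbb R^d$ ($J_x$ is the spatial Jacobian matrix); (c) there is a constant $C>0$ such that $\max\{|(Q^k(t,x)x)_i|,|{\rm Tr}(Q^k(t,x))|,\langle\boldsymbol b^k(t,x),x\rangle\}\le C(1+|x|^2)\mu^k(t,x)$ for every $i=1,\dots,d$, $k=1,\dots,m$, $(t,x)\in[s,T]\times\mathbb R^d$; (d) for every $k=1,\dots,m$ there are positive functions $b^{k,2},b^{k,3}$ and a constant $L_k>0$ such that $|D^h_xb^k_j|\le b^{k,h}$, $|\nabla_xq^k_{ij}|\le L_k\mu^k$, $|D^h_xq^k_{ij}|\le L_k\mu^k$ on $(s,T]\times\mathbb R^d$ for every $i,j=1,\dots,d$ and $h=2,3$, and $r^k+B_{k,2}b^{k,2}+B_{k,3}b^{k,3}\le\mathscr M_k\mu^k$ on $(s,T]\times\mathbb R^d$ for some positive constants $B_{k,2},B_{k,3},\mathscr M_k$; (e) there are positive functions $c^{k,h}$ such that $|D^h_xc_{k\ell}|\le c^{k,h}$ for every $k,\ell=1,\dots,m$ and $h=1,2,3$, and $c^{k,h}\le\overline C(1+|M_k|)$ for every $h,k$ and some constant $\overline C>0$. Here $|D^h_x\cdot|$ is the Euclidean norm of the array of all spatial derivatives of order $h$. For fixed $t\in I$, $\boldsymbol T_t(\tau)$, $\tau\ge0$, is the semigroup on $C_b(\mathbb R^d;\mathbb R^m)$ such that $(\tau,x)\mapsto(\boldsymbol T_t(\tau)\boldsymbol f)(x)$ is the unique classical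 solution (in $C^{1,2}((0,\infty)\times\mathbb R^d;\mathbb R^m)\cap C([0,\infty)\times\mathbb R^d;\mathbb R^m)$), bounded on $[0,\mathcal T]\times\mathbb R^d$ for every $\mathcal T>0$, of the autonomous Cauchy problem $D_\tau\boldsymbol u=\boldsymbol{\mathcal A}(t)\boldsymbol u$, $\boldsymbol u(0,\cdot)=\boldsymbol f$. *)

(* Defs.v *)
From HB Require Import structures.
From mathcomp Require Import all_boot all_order all_algebra.
From mathcomp Require Import all_classical all_reals all_analysis.
Set Implicit Arguments.
Unset Strict Implicit.
Unset Printing Implicit Defensive.
Import Order.TTheory GRing.Theory Num.Theory.
Import numFieldNormedType.Exports.
Local Open Scope classical_set_scope.
Local Open Scope ring_scope.

(* The library norm `|x| on rows is the max norm:
   it is used below only where any equivalent norm gives the same notion;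
   enorm is the Euclidean norm. *)
Definition dotv (R : realType) (d : nat) (x y : 'rV[R]_d) : R :=
  (x *m y^T) 0 0.

Definition enorm (R : realType) (d : nat) (x : 'rV[R]_d) : R :=
  Num.sqrt (dotv x x).

Definition right_halfline (R : realType) (I : set R) : Prop :=
  I = [set: R] \/ exists a : R, I = `]a, +oo[%classic \/ I = `[a, +oo[%classic.

Definition bounded_subinterval (R : realType) (I J : set R) : Prop :=
  [/\ is_interval J, bounded_set J & J `<=` I].

(* An infimum over the finite spectrum: for a symmetric A of positive size it
   is attained. *)
Definition min_eigenvalue (R : realType) (d : nat) (A : 'M[R]_d) : R :=
  inf [set l | eigenvalue A l].

(* partials [:: i1; ...; ih] g is D_{i1} ... D_{ih} g. *)
Definition partials (R : realType) (d : nat) (s : seq 'I_d) (g : 'rV[R]_d -> R) :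
    'rV[R]_d -> R :=
  foldr (fun i h x => 'D_(delta_mx 0 i) h x) g s.

(* All partial derivatives of g of order at most n exist everywhere. *)
Definition pderivable (R : realType) (d n : nat) (g : 'rV[R]_d -> R) : Prop :=
  forall (s : seq 'I_d) (i : 'I_d) (x : 'rV[R]_d),
    (size s < n)%N -> derivable (partials s g) x (delta_mx 0 i).

Definition Cn (R : realType) (d n : nat) (g : 'rV[R]_d -> R) : Prop :=
  pderivable n g /\
  forall s : seq 'I_d, (size s <= n)%N -> continuous (partials s g).

Definition Dnorm (R : realType) (d h : nat) (g : 'rV[R]_d -> R)
    (x : 'rV[R]_d) : R :=
  Num.sqrt (\sum_(s : h.-tuple 'I_d) partials s g x ^+ 2).

(* The space C^{alpha/2, alpha}_loc(I x R^d). *)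
Definition holder_loc (R : realType) (d : nat) (alpha : R) (I : set R)
    (g : R -> 'rV[R]_d -> R) : Prop :=
  forall K : set (R * 'rV[R]_d), compact K -> K `<=` I `*` [set: 'rV[R]_d] ->
  exists M : R, forall p q, K p -> K q ->
    `|g p.1 p.2 - g q.1 q.2|
      <= M * (`|p.1 - q.1| `^ (alpha / 2) + enorm (p.2 - q.2) `^ alpha).

(* The space C^{alpha/2, n + alpha}_loc(I x R^d). *)
Definition Cn_holder_loc (R : realType) (d n : nat) (alpha : R) (I : set R)
    (g : R -> 'rV[R]_d -> R) : Prop :=
  (forall t, I t -> pderivable n (g t)) /\
  forall s : seq 'I_d, (size s <= n)%N ->
    holder_loc alpha I (fun t => partials s (g t)).

(* Coefficients of a system of m equations in d space variables; their values
   at times outside the time interval under consideration are irrelevant. *)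
Record coeffs (R : realType) (d m : nat) := Coeffs {
  diffusion : 'I_m -> R -> 'rV[R]_d -> 'M[R]_d ;
  drift : 'I_m -> R -> 'rV[R]_d -> 'rV[R]_d ;
  coupling : R -> 'rV[R]_d -> 'M[R]_m }.

Definition operator (R : realType) (d m : nat) (A : coeffs R d m) (t : R)
    (zeta : 'rV[R]_d -> 'rV[R]_m) (x : 'rV[R]_d) : 'rV[R]_m :=
  \row_k (\sum_(i < d) \sum_(j < d)
            diffusion A k t x i j * partials [:: i; j] (fun y => zeta y 0 k) x
          + \sum_(j < d) drift A k t x 0 j * partials [:: j] (fun y => zeta y 0 k) x
          + \sum_(h < m) coupling A t x k h * zeta x 0 h).

Definition coeffsP (R : realType) (d m : nat) (A : coeffs R d m) :
    coeffs R d m :=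
  Coeffs (diffusion A) (drift A)
    (fun t x => \matrix_(k, h)
       if h == k then coupling A t x k h else `|coupling A t x k h|).

Definition rowsumP (R : realType) (d m : nat) (A : coeffs R d m) (k : 'I_m)
    (t : R) (x : 'rV[R]_d) : R :=
  \sum_(j < m) coupling (coeffsP A) t x k j.

Definition mu (R : realType) (d m : nat) (A : coeffs R d m) (k : 'I_m)
    (t : R) (x : 'rV[R]_d) : R :=
  min_eigenvalue (diffusion A k t x).

Definition coeffs_Cn_holder_loc (R : realType) (d m n : nat) (alpha : R)
    (I : set R) (A : coeffs R d m) : Prop :=
  [/\ forall k i j, Cn_holder_loc n alpha I (fun t x => diffusion A k t x i j),
      forall k j, Cn_holder_loc n alpha I (fun t x => drift A k t x 0 j) &
      forall k h, Cn_holder_loc n alpha I (fun t x => coupling A t x k h)].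

Definition cond_i (R : realType) (d m : nat) (alpha : R) (I : set R)
    (A : coeffs R d m) : Prop :=
  (forall k t x, I t -> (diffusion A k t x)^T = diffusion A k t x) /\
  coeffs_Cn_holder_loc 0 alpha I A.

Definition cond_ii (R : realType) (d m : nat) (I : set R)
    (A : coeffs R d m) : Prop :=
  forall (J : set R) (k : 'I_m), bounded_subinterval I J ->
    (0 < ereal_inf
           [set (mu A k p.1 p.2)%:E | p in J `*` [set: 'rV[R]_d]])%E.

Definition cond_iii (R : realType) (d m : nat) (I : set R)
    (A : coeffs R d m) : Prop :=
  forall J : set R, bounded_subinterval I J ->
  exists (phi : 'rV[R]_d -> 'rV[R]_m) (lambda : R),
    [/\ forall k, Cn 2 (fun x => phi x 0 k),
        forall x k, 0 < phi x 0 k,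
        forall k (M : R), exists r : R, forall x, r < enorm x -> M < phi x 0 k,
        0 < lambda &
        forall t x k, J t ->
          operator (coeffsP A) t phi x 0 k <= lambda * phi x 0 k].

Definition cond_iv (R : realType) (d m : nat) (I : set R)
    (A : coeffs R d m) : Prop :=
  ~ exists K : {set 'I_m}, (0 < #|K| < m)%N /\
      forall i j, i \in K -> j \notin K ->
        forall t x, I t -> coupling (coeffsP A) t x i j = 0.

Definition cond_v (R : realType) (d m : nat) (I : set R)
    (A : coeffs R d m) : Prop :=
  forall (J : set R) (k : 'I_m), bounded_subinterval I J ->
  exists kappa : R, forall t x, J t -> rowsumP A k t x <= kappa.

(* The library's Jacobian 'J acts on row vectors from the right. *)
Definition cond_b (R : realType) (d m : nat) (s T : R) (A : coeffs R d m)
    (r : 'I_m -> R -> 'rV[R]_d -> R) : Prop :=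
  forall k t (x xi : 'rV[R]_d), s <= t <= T ->
    dotv (xi *m 'J (drift A k t) x) xi <= r k t x * enorm xi ^+ 2.

Definition cond_c (R : realType) (d m : nat) (s T : R)
    (A : coeffs R d m) : Prop :=
  exists C : R, 0 < C /\
  forall (i : 'I_d) k t (x : 'rV[R]_d), s <= t <= T ->
    Num.max (Num.max `|(diffusion A k t x *m x^T) i 0|
                     `|\tr (diffusion A k t x)|)
            (dotv (drift A k t x) x)
      <= C * (1 + enorm x ^+ 2) * mu A k t x.

Definition cond_d (R : realType) (d m : nat) (s T : R) (A : coeffs R d m)
    (r : 'I_m -> R -> 'rV[R]_d -> R) : Prop :=
  forall k : 'I_m,
  exists (b2 b3 : R -> 'rV[R]_d -> R) (L B2 B3 M : R),
    [/\ 0 < L, 0 < B2, 0 < B3 & 0 < M] /\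
    forall t x, s < t <= T ->
      [/\ 0 < b2 t x /\ 0 < b3 t x,
          forall j : 'I_d,
            Dnorm 2 (fun y => drift A k t y 0 j) x <= b2 t x /\
            Dnorm 3 (fun y => drift A k t y 0 j) x <= b3 t x,
          forall (i j : 'I_d) (h : nat), (1 <= h <= 3)%N ->
            Dnorm h (fun y => diffusion A k t y i j) x <= L * mu A k t x &
          r k t x + B2 * b2 t x + B3 * b3 t x <= M * mu A k t x].

Definition cond_e (R : realType) (d m : nat) (s T : R)
    (A : coeffs R d m) : Prop :=
  exists (c : 'I_m -> nat -> R -> 'rV[R]_d -> R) (Cbar : R),
    forall k (h : nat) t x, (1 <= h <= 3)%N -> s <= t <= T ->
      [/\ 0 < c k h t x,
          forall l : 'I_m,
            Dnorm h (fun y => coupling A t y k l) x <= c k h t x &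
          c k h t x <= Cbar * (1 + `|rowsumP A k t x|)].

Definition Cb (R : realType) (d m : nat) (f : 'rV[R]_d -> 'rV[R]_m) : Prop :=
  continuous f /\ bounded_fun f.

(* u is a classical solution of D_tau u = A(t) u, u(0, .) = f (the time t is
   frozen), bounded on each strip [0, T] x R^d.  Only the values u tau for
   0 <= tau matter. *)
Definition bounded_classical_solution (R : realType) (d m : nat)
    (A : coeffs R d m) (t : R) (f : 'rV[R]_d -> 'rV[R]_m)
    (u : R -> 'rV[R]_d -> 'rV[R]_m) : Prop :=
  let open_strip := [set p : R * 'rV[R]_d | 0 < p.1] in
  let closed_strip := [set p : R * 'rV[R]_d | 0 <= p.1] in
  [/\ {within closed_strip, continuous (fun p : R * 'rV[R]_d => u p.1 p.2)},
      (forall (tau : R) x, 0 < tau -> derivable (fun sigma => u sigma x) tau 1) /\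
      {within open_strip, continuous
        (fun p : R * 'rV[R]_d => derive1 (fun sigma => u sigma p.2) p.1)},
      forall k : 'I_m,
        (forall tau : R, 0 < tau -> pderivable 2 (fun y => u tau y 0 k)) /\
        forall s : seq 'I_d, (size s <= 2)%N ->
          {within open_strip, continuous
            (fun p : R * 'rV[R]_d => partials s (fun y => u p.1 y 0 k) p.2)},
      (forall (tau : R) x, 0 < tau ->
         derive1 (fun sigma => u sigma x) tau = operator A t (u tau) x) /\
      (forall x, u 0 x = f x) &
      forall T : R,
        [bounded u p.1 p.2 | p in [set p : R * 'rV[R]_d | 0 <= p.1 <= T]]].

(* S t tau f is T_t(tau) f.  Unique solvability determines S t tau on C_b for
   t in I and 0 <= tau; the semigroup law and linearity follow from it. *)
Definition frozen_semigroups (R : realType) (d m : nat) (I : set R)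
    (A : coeffs R d m)
    (S : R -> R -> ('rV[R]_d -> 'rV[R]_m) -> 'rV[R]_d -> 'rV[R]_m) : Prop :=
  forall t f, I t -> Cb f ->
    bounded_classical_solution A t f (fun tau => S t tau f) /\
    forall v, bounded_classical_solution A t f v ->
      forall (tau : R) x, 0 <= tau -> v tau x = S t tau f x.

(* Uniform convergence on compact subsets of D: for locally compact D this is
   locally uniform convergence. *)
Definition locally_uniform_cvg (U : topologicalType) (V : uniformType)
    (D : set U) (F : nat -> U -> V) (f : U -> V) : Prop :=
  forall K : set U, compact K -> K `<=` D -> {uniform K, F @ \oo --> f}.

(* Main.v *)
Require Import Defs.
From HB Require Import structures.
From mathcomp Require Import all_boot all_order all_algebra.
From mathcomp Require Import all_classical all_reals all_analysis.
From mathcomp Require Import ring lra.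
Import Order.TTheory GRing.Theory Num.Theory.
Import numFieldNormedType.Exports.
Local Open Scope classical_set_scope.
Local Open Scope ring_scope.

(** Only the maximum principle and the regularity of one fixed solution enter:
    no a priori estimate is used that would be uniform over the frozen time t.

    The equations are coupled through the zero order terms alone. Hence, if v
    solves v_tau = A(t) v + g on a cylinder and z strictly satisfies
    z_tau > A^P(t) z + |g| there, with |v_k| < z_k on the parabolic boundary,
    then |v_k| < z_k inside (parabolic_comparison): at the first contact time
    the function z_k - sigma v_k, sigma the sign of v_k, has a spatial minimum
    with value zero, so its time derivative is nonpositive, its gradient vanishes and
    its Hessian contracts nonnegatively against Q^k (psd_contraction_ge0), while
    the coupling terms are nonnegative because |v_h| <= z_h for every h.

    Three barriers are fed into this comparison, all with constants uniform over
    bounded sets of frozen times. The function F e^(kappa tau) plus a vanishing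
    multiple of the Lyapunov function phi gives a uniform sup bound for the
    solutions (solution_sup_bound). On the unit ball around x0,
    2 eps + K |x - x0|^2 + L tau shows that T_t(tau) f tends to f as tau -> 0,
    locally uniformly in x and in t (small_time_uniform). Finally
    a e^((lam + 1)(tau - t0)) phi converts smallness of initial data and source
    on a large ball, plus mere boundedness outside, into smallness on a given
    smaller ball (barrier_stability).

    Convergence for data converging locally uniformly is then immediate, since
    the difference of the two solutions has no source (initial_data_stability).
    For continuity in t compare u = T_t(.) f with the fixed solution
    u0 = T_t0(.) f. The difference solves the equation of A(t) with source
    (A(t) - A(t0)) u0. On [delta, tau1] times a ball, u0 and its derivatives up
    to order two are bounded by compactness, so the Hoelder continuity of the
    coefficients in t makes the source small; up to time delta both solutions
    are close to f. Hence u - u0 is small, uniformly in tau in [0, tau1] and in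
    x in a ball (frozen_time_continuity), and continuity of u0 in (tau, x)
    yields joint continuity. *)

Set Implicit Arguments.
Unset Strict Implicit.
Unset Printing Implicit Defensive.

(** * Nonnegative quadratic forms *)

Lemma cvg_sum_fin (R : realType) (U : Type) (F : set_system U) (FF : Filter F)
    (I : finType) (f : I -> U -> R) (l : I -> R) :
  (forall i, f i x @[x --> F] --> l i) ->
  \sum_i f i x @[x --> F] --> \sum_i l i.
Proof.
move=> fl; elim: (index_enum I) => [|i r IH].
  by under eq_fun do rewrite big_nil; rewrite big_nil; exact: cvg_cst.
by under eq_fun do rewrite big_cons; rewrite big_cons; exact: cvgD.
Qed.

Lemma rV_norm_leP (R : realType) n (x : 'rV[R]_n) (M : R) :
  0 <= M -> reflect (forall i, `|x 0 i| <= M) (`|x| <= M).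
Proof.
move=> M0; rewrite [`|x|]mx_normrE.
apply: (iffP idP) => [h i|h].
  by apply: le_trans h; apply: (@le_bigmax _ _ _ _ (fun ij : 'I_1 * 'I_n => `|x ij.1 ij.2|) (0, i)).
by apply/bigmax_leP; split => // -[i j] _ /=; rewrite ord1.
Qed.

Lemma rV_norm_coord (R : realType) n (x : 'rV[R]_n) i : `|x 0 i| <= `|x|.
Proof. by move: i; apply/rV_norm_leP. Qed.

Definition bform (R : realType) (n : nat) (Q : 'M[R]_n) (x y : 'rV[R]_n) : R :=
  (x *m Q *m y^T) 0 0.

Lemma bformE (R : realType) n (Q : 'M[R]_n) (x y : 'rV[R]_n) :
  bform Q x y = \sum_i \sum_j Q i j * (x 0 i * y 0 j).
Proof.
rewrite /bform mxE exchange_big; apply: eq_bigr => j _ /=.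
rewrite !mxE mulr_suml; apply: eq_bigr => i _.
by rewrite mulrAC mulrC.
Qed.

Lemma bformDl (R : realType) n (Q : 'M[R]_n) (x x' y : 'rV[R]_n) :
  bform Q (x + x') y = bform Q x y + bform Q x' y.
Proof. by rewrite /bform !mulmxDl mxE. Qed.

Lemma bformZl (R : realType) n (Q : 'M[R]_n) a (x y : 'rV[R]_n) :
  bform Q (a *: x) y = a * bform Q x y.
Proof. by rewrite /bform -!scalemxAl mxE. Qed.

Lemma bformC (R : realType) n (Q : 'M[R]_n) (x y : 'rV[R]_n) :
  Q^T = Q -> bform Q x y = bform Q y x.
Proof.
move=> QT; rewrite /bform -[in RHS](trmxK (y *m Q *m x^T)) [in RHS]mxE.
by rewrite !trmx_mul !trmxK QT mulmxA.
Qed.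

Lemma bform_delta (R : realType) n (Q : 'M[R]_n) (x : 'rV[R]_n) j :
  bform Q x (delta_mx 0 j) = (x *m Q) 0 j.
Proof.
by rewrite /bform trmx_delta -colE mxE.
Qed.

Definition psd (R : realType) (n : nat) (Q : 'M[R]_n) : Prop :=
  forall x : 'rV[R]_n, 0 <= bform Q x x.

Lemma psd_cauchy_schwarz (R : realType) n (Q : 'M[R]_n) (x y : 'rV[R]_n) :
  Q^T = Q -> psd Q ->
  bform Q x y ^+ 2 <= bform Q x x * bform Q y y.
Proof.
move=> QT Qpsd.
set a := bform Q x x; set b := bform Q x y; set c := bform Q y y.
have poly_ge0 u v : 0 <= u ^+ 2 * a + 2 * u * v * b + v ^+ 2 * c.
  have := Qpsd (u *: x + v *: y).
  rewrite bformDl !bformZl ![bform Q _ (_ + _)]bformC // !bformDl !bformZl.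
  rewrite -/a -/c [bform Q y x]bformC // -/b.
  by move=> h; apply: le_trans h _; lra.
have a0 : 0 <= a by exact: Qpsd.
have c0 : 0 <= c by exact: Qpsd.
have [ap|] := ltP 0 a.
  (* At (u, v) = (-b, a) the polynomial equals a (a c - b^2). *)
  have := poly_ge0 (- b) a; rewrite sqrrN => h.
  have : 0 <= a * (a * c - b ^+ 2).
    by apply: le_trans h _; lra.
  by rewrite pmulr_rge0 // subr_ge0.
move=> a_le0; have a00 : a = 0 by apply/eqP; rewrite eq_le a_le0.
rewrite a00 mul0r; have [->|bn0] := eqVneq b 0; first by rewrite expr0n.
(* With a = 0 the polynomial is affine in u; here it equals -(c + 2) b^2. *)
have := poly_ge0 (- (c + 1)) b.
rewrite a00 mulr0 add0r => h.
have : 0 <= - (c + 2) * b ^+ 2 by apply: le_trans h _; lra.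
by rewrite mulNr oppr_ge0 pmulr_rle0 //; lra.
Qed.

(** Symmetric Gaussian elimination: subtracting the rank one form
    l^T l / q_ii, where l is the i-th row, kills the i-th row and column and keeps
    the form nonnegative by Cauchy-Schwarz; the contraction of H against the rank
    one form is H(l, l) / q_ii. *)
Lemma psd_contraction_ge0 (R : realType) n (Q H : 'M[R]_n) :
  Q^T = Q -> psd Q -> psd H -> 0 <= \sum_i \sum_j Q i j * H i j.
Proof.
move=> QT Qpsd Hpsd.
suff elim k (Q' : 'M[R]_n) : Q'^T = Q' -> psd Q' ->
    forall S : {set 'I_n}, (#|S| <= k)%N -> (forall i, i \notin S -> row i Q' = 0) ->
    0 <= \sum_i \sum_j Q' i j * H i j.
  by apply: (elim n Q QT Qpsd [set: 'I_n]%SET) => [|i]; rewrite ?cardsT ?card_ord ?inE.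
elim: k Q' {QT Qpsd Q} => [|k IH] Q QT Qpsd S cardS Q0.
  rewrite big1 // => i _; rewrite big1 // => j _.
  have /rowP/(_ j) : row i Q = 0.
    apply: Q0; move: cardS; rewrite leqn0 cards_eq0 => /eqP ->; by rewrite inE.
  by rewrite !mxE => ->; rewrite mul0r.
have [S0|[i iS]] := set_0Vmem S.
  by apply: (IH Q QT Qpsd S) => //; rewrite S0 cards0.
have Qe x : bform Q x (delta_mx 0 i) = (x *m Q) 0 i by exact: bform_delta.
have Qii : bform Q (delta_mx 0 i) (delta_mx 0 i) = Q i i.
  by rewrite Qe -rowE mxE.
have Qsym a b : Q a b = Q b a by rewrite -[in LHS]QT mxE.
have Qii0 : 0 <= Q i i by rewrite -Qii; exact: Qpsd.
have [qi0|qin0] := eqVneq (Q i i) 0.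
  apply: (IH Q QT Qpsd (S :\ i)%SET) => [|j].
    by move: cardS; rewrite (cardsD1 i S) iS.
  rewrite !inE negb_and negbK => /orP[/eqP ->|]; last exact: Q0.
  apply/rowP => b; rewrite !mxE; apply/eqP; rewrite -sqrf_eq0 eq_le sqr_ge0 andbT.
  have := psd_cauchy_schwarz (delta_mx 0 b) (delta_mx 0 i) QT Qpsd.
  by rewrite Qii qi0 mulr0 Qe -rowE mxE Qsym.
have qi_gt0 : 0 < Q i i by rewrite lt_def qin0.
pose l : 'rV[R]_n := row i Q.
pose Q1 : 'M[R]_n := \matrix_(a, b) (Q a b - l 0 a * l 0 b / Q i i).
have Q1E a b : Q a b = Q1 a b + (Q i i)^-1 * (l 0 a * l 0 b).
  by rewrite mxE; ring.
have lE x : (x *m Q) 0 i = \sum_a x 0 a * l 0 a.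
  by rewrite mxE; apply: eq_bigr => a _; rewrite mxE (Qsym a).
have bQ1 x : bform Q x x
    = bform Q1 x x + (Q i i)^-1 * bform Q x (delta_mx 0 i) ^+ 2.
  rewrite Qe lE expr2 mulr_suml mulr_sumr !bformE -big_split /=.
  apply: eq_bigr => a _; rewrite mulr_sumr mulr_sumr -big_split /=.
  by apply: eq_bigr => b _; rewrite Q1E; ring.
have -> : \sum_a \sum_b Q a b * H a b
    = \sum_a \sum_b Q1 a b * H a b + (Q i i)^-1 * bform H l l.
  rewrite bformE mulr_sumr -big_split /=; apply: eq_bigr => a _.
  rewrite mulr_sumr -big_split /=; apply: eq_bigr => b _.
  by rewrite Q1E; ring.
apply: addr_ge0; last by rewrite mulr_ge0 ?invr_ge0.
apply: (IH Q1 _ _ (S :\ i)%SET) => [|x||j].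
- by apply/matrixP => a b; rewrite !mxE (Qsym a b) (mulrC (Q i a)).
- have := psd_cauchy_schwarz x (delta_mx 0 i) QT Qpsd.
  rewrite Qii -ler_pdivrMr // => h.
  by move: h; rewrite (bQ1 x) mulrC lerDr.
- by move: cardS; rewrite (cardsD1 i S) iS.
- rewrite !inE negb_and negbK => /orP[/eqP ->|jS]; apply/rowP => b; rewrite !mxE.
    by rewrite mulrAC divff // mul1r subrr.
  have /rowP jr := Q0 j jS.
  have := jr b; have := jr i; rewrite !mxE (Qsym j i) => -> ->.
  by rewrite !mul0r subrr.
Qed.

Lemma bform_continuous (R : realType) n (Q : 'M[R]_n) :
  continuous (fun x : 'rV[R]_n => bform Q x x).
Proof.
under eq_fun do rewrite bformE.
move=> x; apply: (@cvg_sum_fin _ _ (nbhs x)) => i; apply: (@cvg_sum_fin _ _ (nbhs x)) => j.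
apply: cvgM; first exact: cvg_cst.
by apply: cvgM; apply: coord_continuous.
Qed.

(** The minimum of the quadratic form over the unit sphere is attained, and by
    Cauchy-Schwarz for the form Q - lambda a minimiser is an eigenvector. *)
Lemma psd_of_eigenvalues (R : realType) n (Q : 'M[R]_n) :
  Q^T = Q -> (forall l, eigenvalue Q l -> 0 <= l) -> psd Q.
Proof.
move=> QT Qev.
have normE (x : 'rV[R]_n) : bform 1%:M x x = \sum_i x 0 i ^+ 2.
  by rewrite /bform mulmx1 mxE; apply: eq_bigr => i _; rewrite mxE expr2.
have norm_ge0 (x : 'rV[R]_n) : 0 <= bform 1%:M x x.
  by rewrite normE sumr_ge0 // => i _; exact: sqr_ge0.
have norm_eq0 (x : 'rV[R]_n) : bform 1%:M x x = 0 -> x = 0.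
  rewrite normE => /eqP; rewrite psumr_eq0 => [|i _]; last exact: sqr_ge0.
  move=> /allP x0; apply/rowP => i; rewrite mxE; apply/eqP.
  by rewrite -sqrf_eq0; apply: x0; rewrite mem_index_enum.
have scal (x : 'rV[R]_n) : x != 0 -> exists2 a, a != 0 & bform 1%:M (a *: x) (a *: x) = 1.
  move=> x0; have N0 : 0 < bform 1%:M x x.
    rewrite lt_def; apply/andP; split; last exact: (norm_ge0 x).
    by apply: contra x0 => /eqP/norm_eq0/eqP.
  exists (Num.sqrt (bform 1%:M x x))^-1.
    by rewrite invr_eq0 gt_eqF // sqrtr_gt0.
  rewrite bformZl bformC ?trmx1 // bformZl mulrA -expr2 exprVn sqr_sqrtr //.
  by rewrite mulVf // gt_eqF.
have [all0|] := pselect (forall x : 'rV[R]_n, x = 0).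
  by move=> x; rewrite (all0 x) /bform !mul0mx mxE.
move=> /existsNP[x1 /eqP x10].
pose sphere := [set x : 'rV[R]_n | bform 1%:M x x = 1].
have [x0 sx0 x0min] : exists2 c, c \in sphere & forall t, t \in sphere ->
    bform Q c c <= bform Q t t.
  apply: EVT_min_rV.
  - have [a _ h] := scal x1 x10; by exists (a *: x1).
  - apply: bounded_closed_compact.
      exists 1; split; first exact: num_real.
      move=> M M1 x; rewrite /sphere /= normE => sx.
      apply/rV_norm_leP => [|i]; first lra.
      apply: le_trans (ltW M1); rewrite -(@expr_le1 _ 2) // real_normK ?num_real //.
      by rewrite -sx (bigD1 i) //= lerDl sumr_ge0 // => j _; exact: sqr_ge0.
    apply: (@closed_comp _ _ (fun x => bform 1%:M x x) [set 1]).
      by move=> x _; exact: bform_continuous.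
    exact: closed_eq.
  - by apply: continuous_subspaceT; exact: bform_continuous.
move: sx0; rewrite inE /sphere /= => sx0.
set l := bform Q x0 x0 in x0min.
have Qge x : l * bform 1%:M x x <= bform Q x x.
  have [->|xn0] := eqVneq x 0; first by rewrite /bform !mul0mx mxE mulr0.
  have [a an0 ax] := scal x xn0.
  have := x0min (a *: x); rewrite inE => /(_ ax).
  have a2 : 0 < a ^+ 2 by rewrite lt_def sqrf_eq0 an0 sqr_ge0.
  move: ax; rewrite !bformZl !(@bformC _ _ _ x (a *: x)) ?trmx1 // !bformZl.
  rewrite !mulrA -!expr2 => ax h.
  by rewrite -(ler_pM2l a2) mulrCA ax mulr1.
have bsub x y : bform (Q - l%:M) x y = bform Q x y - l * bform 1%:M x y.
  have subE (M N : 'M[R]_1) : (M - l *: N) 0 0 = M 0 0 - l * N 0 0 by rewrite !mxE.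
  by rewrite -(scalemx1 _ l) /bform mulmxBr mulmxBl -scalemxAr -scalemxAl subE.
have BT : (Q - l%:M)^T = Q - l%:M by rewrite linearB /= QT tr_scalar_mx.
have Bpsd : psd (Q - l%:M) by move=> x; rewrite bsub subr_ge0.
have x0ev : eigenvalue Q l.
  apply/eigenvalueP; exists x0; last first.
    apply/eqP => x00; move: sx0; rewrite x00 /bform !mul0mx mxE => /eqP.
    by rewrite eq_sym oner_eq0.
  apply/rowP => j; have := psd_cauchy_schwarz x0 (delta_mx 0 j) BT Bpsd.
  rewrite (bsub x0 x0) -/l sx0 mulr1 subrr mul0r => h.
  have : bform (Q - l%:M) x0 (delta_mx 0 j) == 0.
    by rewrite -sqrf_eq0 eq_le h sqr_ge0.
  rewrite bform_delta mulmxBr mul_mx_scalar [X in X == _]mxE [X in _ + X]mxE subr_eq0 => /eqP h1.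
  by rewrite h1 mxE.
move=> x; apply: le_trans (Qge x); apply: mulr_ge0; [exact: Qev|exact: norm_ge0].
Qed.

(** * Continuous partial derivatives and interior minima *)

#[local] Arguments partials : simpl never.

Lemma within_continuousP (R : realType) (V W : normedModType R) (D : set V)
    (f : V -> W) :
  {within D, continuous f} <->
  forall p, D p -> forall e : R, 0 < e ->
    exists2 del : R, 0 < del & forall q, D q -> `|p - q| < del -> `|f p - f q| < e.
Proof.
split=> [/subspace_continuousP fc p Dp e e0|fc].
  have /cvgrPdist_lt/(_ e e0) := fc p Dp.
  rewrite near_withinE => /nbhs_normP[del /= del0 h].
  by exists del => // q Dq pq; apply: h.
apply/subspace_continuousP => p Dp; apply/cvgrPdist_lt => e e0.
rewrite near_withinE; apply/nbhs_normP.
by have [del del0 h] := fc p Dp e e0; exists del => //= q pq Dq; exact: h.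
Qed.

Lemma continuous_dist (R : realType) (V W : normedModType R) (f : V -> W) (p : V) :
  {for p, continuous f} ->
  forall e : R, 0 < e ->
    exists2 del : R, 0 < del & forall q, `|p - q| < del -> `|f p - f q| < e.
Proof.
move=> fc e e0; have /cvgrPdist_lt/(_ e e0) := fc.
by move=> /nbhs_normP[del /= del0 h]; exists del.
Qed.

Lemma continuous_of_dist (R : realType) (V W : normedModType R) (f : V -> W) :
  (forall p (e : R), 0 < e ->
    exists2 del : R, 0 < del & forall q, `|p - q| < del -> `|f p - f q| < e) ->
  continuous f.
Proof.
move=> H p; apply/(@cvgrPdist_lt _ _ _ (nbhs p)) => e e0; apply/nbhs_normP.
by have [del del0 h] := H p e e0; exists del.
Qed.

Section partial_derivatives.
Variables (R : realType) (n : nat).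
Implicit Types (g h : 'rV[R]_n -> R) (x v w : 'rV[R]_n).

Lemma norm_delta i (a : R) : `|a *: (delta_mx 0 i : 'rV[R]_n)| = `|a|.
Proof.
apply/eqP; rewrite eq_le; apply/andP; split.
  apply/rV_norm_leP => // j; rewrite !mxE eqxx /=.
  by case: (_ == _); rewrite ?mulr1 ?mulr0 ?normr0.
have := rV_norm_coord (a *: (delta_mx 0 i : 'rV[R]_n)) i.
by rewrite !mxE !eqxx mulr1.
Qed.

Lemma is_derive_line g x v (t : R) :
  derivable g (x + t *: v) v ->
  is_derive t 1 (fun u : R => g (x + u *: v)) ('D_v g (x + t *: v)).
Proof.
move=> dg.
have e : (fun h : R => h^-1 *: (((fun u : R => g (x + u *: v)) \o shift t) (h *: 1)
            - g (x + t *: v)))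
    = (fun h : R => h^-1 *: ((g \o shift (x + t *: v)) (h *: v) - g (x + t *: v))).
  apply/funext => h /=; congr (_ *: (g _ - _)).
  by rewrite [h%:A]mulr1 scalerDl addrCA.
by split; rewrite /derivable /derive e.
Qed.

Lemma mean_value (phi dphi : R -> R) (a : R) :
  (forall t : R, is_derive t 1 phi (dphi t)) ->
  exists2 c, `|c| <= `|a| & phi a - phi 0 = dphi c * a.
Proof.
move=> dp.
have cont (i : interval R) : {within [set` i], continuous phi}.
  by apply: derivable_within_continuous => t _; exact: ex_derive.
have [a0|a0] := leP 0 a.
  have [c] := @MVT_segment _ phi dphi 0 a a0 (fun t _ => dp t) (cont _).
  rewrite in_itv /= => /andP[c0 ca] e; exists c; last by rewrite e subr0.
  by rewrite !ger0_norm.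
have [c] := @MVT_segment _ phi dphi a 0 (ltW a0) (fun t _ => dp t) (cont _).
rewrite in_itv /= => /andP[c0 ca] e; exists c.
  by rewrite !ler0_norm ?lerN2 // ltW.
by rewrite -opprB e sub0r mulrN opprK.
Qed.

Lemma partial_mean_value g x i (a : R) : pderivable 1 g ->
  exists2 c, `|c| <= `|a| &
    g (x + a *: delta_mx 0 i) - g x = partials [:: i] g (x + c *: delta_mx 0 i) * a.
Proof.
move=> dg.
have dl (t : R) : is_derive t 1 (fun u => g (x + u *: delta_mx 0 i))
    (partials [:: i] g (x + t *: delta_mx 0 i)).
  by apply: is_derive_line; exact: (dg [::]).
by have [c ca e] := mean_value a dl; exists c => //; rewrite -e scale0r addr0.
Qed.

(** Edge by edge: the mean value theorem on the edge along the i-th coordinate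
    gives v_i times a value of the i-th partial at a point within del of x. *)
Lemma partials_increment g x (e del : R) : pderivable 1 g ->
  (forall y, `|y - x| < del ->
     forall i, `|partials [:: i] g y - partials [:: i] g x| <= e) ->
  forall v (r : seq 'I_n), \sum_(i <- r) `|v 0 i| < del ->
  `|g (x + \sum_(i <- r) v 0 i *: delta_mx 0 i) - g x
      - \sum_(i <- r) v 0 i * partials [:: i] g x| <= e * \sum_(i <- r) `|v 0 i|.
Proof.
move=> dg gx v; elim=> [|i r IH].
  by rewrite !big_nil addr0 subrr subr0 normr0 mulr0.
rewrite !big_cons => lt_del.
set w := \sum_(j <- r) _ *: _ in IH *.
have w_le : `|w| <= \sum_(j <- r) `|v 0 j|.
  by apply: le_trans (ler_norm_sum _ _ _) _; apply: ler_sum => j _; rewrite norm_delta.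
have vi0 : 0 <= `|v 0 i| by [].
have [c cv ec] := partial_mean_value (x + w) i (v 0 i) dg.
set D := partials [:: i] g _ in ec.
have D_le : `|D - partials [:: i] g x| <= e.
  apply: gx; rewrite -[x + w + _]addrA [x + _]addrC addrK.
  apply: le_lt_trans (ler_normD _ _) _; rewrite norm_delta.
  by apply: le_lt_trans lt_del; rewrite addrC lerD.
have IH' := IH (le_lt_trans (ler_wpDl vi0 (lexx _)) lt_del).
rewrite [_ *: _ + w]addrC addrA.
rewrite (_ : _ - _ - _ = (g (x + w) - g x - \sum_(j <- r) v 0 j * partials [:: j] g x)
   + v 0 i * (D - partials [:: i] g x)); last first.
  by rewrite mulrBr [v 0 i * D]mulrC -ec; ring.
apply: le_trans (ler_normD _ _) _; rewrite [leRHS]mulrDr [leLHS]addrC lerD //.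
by rewrite normrM mulrC ler_wpM2r.
Qed.

(** Near x each partial varies by at most e / (n + 1), and the sum of the |v_i| is
    at most n |v|. *)
Lemma partials_taylor1 g x (e : R) : Cn 1 g -> 0 < e ->
  exists2 del : R, 0 < del & forall v, `|v| < del ->
  `|g (x + v) - g x - \sum_i v 0 i * partials [:: i] g x| <= e * `|v|.
Proof.
move=> [dg cg] e0.
pose e' := e / n.+1%:R.
have e'0 : 0 < e' by rewrite divr_gt0.
have [del del0 hdel] : exists2 del : R, 0 < del & forall y, `|y - x| < del ->
     forall i, `|partials [:: i] g y - partials [:: i] g x| <= e'.
  have h (i : 'I_n) : \forall y \near x, `|partials [:: i] g y - partials [:: i] g x| <= e'.
    have [del del0 h] := continuous_dist (cg [:: i] isT x) e'0.
    by apply/nbhs_normP; exists del => //= y /h; rewrite distrC => /ltW.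
  have /nbhs_normP[del /= del0 hd] := filter_forall (nbhs_filter x) h.
  by exists del => // y yx i; apply: hd; rewrite /= distrC.
have n0 : 0 < n.+1%:R :> R by [].
exists (del / n.+1%:R); first by rewrite divr_gt0.
move=> v vdel.
have sum_le : \sum_(i < n) `|v 0 i| <= n.+1%:R * `|v|.
  apply: le_trans (_ : \sum_(i < n) `|v| <= _).
    by apply: ler_sum => i _; exact: rV_norm_coord.
  by rewrite sumr_const card_ord -[leLHS]mulr_natl ler_wpM2r // ler_nat.
have lt_del : \sum_(i < n) `|v 0 i| < del.
  by apply: le_lt_trans sum_le _; rewrite mulrC -ltr_pdivlMr.
have := partials_increment dg hdel lt_del.
rewrite -row_sum_delta => h; apply: le_trans h _.
by rewrite /e' mulrAC ler_pdivrMr // -mulrA ler_pM2l // mulrC.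
Qed.

Lemma is_derive_line_partials g x v (t : R) : Cn 1 g ->
  is_derive t 1 (fun u : R => g (x + u *: v))
    (\sum_i v 0 i * partials [:: i] g (x + t *: v)).
Proof.
move=> Cg; set y := x + t *: v.
suff : h^-1 *: (((fun u : R => g (x + u *: v)) \o shift t) (h *: 1) - g y) @[h --> 0^']
    --> \sum_i v 0 i * partials [:: i] g y.
  move=> c; split; last exact/cvg_lim.
  by apply/cvg_ex; eexists; exact: c.
apply/cvgrPdist_le => e e0.
have v1 : 0 < `|v| + 1 by rewrite ltr_wpDl.
have [del del0 hd] := partials_taylor1 y Cg (divr_gt0 e0 v1).
rewrite near_withinE; apply/nbhs_normP; exists (del / (`|v| + 1)) => /=.
  by rewrite divr_gt0.
move=> h; rewrite /= sub0r normrN => hlt h0.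
have hv : `|h *: v| <= `|h| * (`|v| + 1) by rewrite normrZ ler_wpM2l // lerDl.
have := hd (h *: v); rewrite (le_lt_trans hv) -?ltr_pdivlMr // => /(_ isT) hle.
have -> : x + (h%:A + t) *: v = y + h *: v.
  by rewrite [h%:A]mulr1 /y scalerDl addrA addrAC.
move: hle; have -> : \sum_i (h *: v) 0 i * partials [:: i] g y
    = h * \sum_i v 0 i * partials [:: i] g y.
  by rewrite mulr_sumr; apply: eq_bigr => i _; rewrite mxE mulrA.
set S := \sum_i _; set G := _ - g y => hle.
have h00 : 0 < `|h| by rewrite normr_gt0.
rewrite -(ler_pM2l h00) -normrM [h * _]mulrBr mulrA divff // mul1r distrC.
apply: le_trans hle _.
rewrite [leRHS](_ : _ = e / (`|v| + 1) * (`|h| * (`|v| + 1))).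
  by rewrite ler_pM2l // divr_gt0.
by field; rewrite gt_eqF.
Qed.

Lemma local_min_critical h x (del : R) i : 0 < del -> pderivable 1 h ->
  (forall y, `|y - x| < del -> h x <= h y) -> partials [:: i] h x = 0.
Proof.
move=> del0 dh hmin.
have dl (t : R) : is_derive t 1 (fun u => h (x + u *: delta_mx 0 i))
    (partials [:: i] h (x + t *: delta_mx 0 i)).
  by apply: is_derive_line; exact: (dh [::]).
have [_ d0] := dl 0; rewrite scale0r addr0 in d0; rewrite -d0.
suff [_] : is_derive (0 : R) 1 (fun u : R => h (x + u *: delta_mx 0 i)) 0 by [].
apply: (@derive1_at_min _ _ (- del) del) => [|t _||t]; first by lra.
- by have [] := dl t.
- by rewrite in_itv /=; lra.
rewrite in_itv /= => tdel; rewrite scale0r addr0; apply: hmin.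
by rewrite addrC addKr norm_delta ltr_norml.
Qed.

Lemma Cn_partials g i : Cn 2 g -> Cn 1 (partials [:: i] g).
Proof.
move=> [dg cg]; have pE s : partials s (partials [:: i] g) = partials (rcons s i) g.
  by rewrite /partials -cats1 foldr_cat.
split=> [s j x|s] ss; rewrite pE.
  by apply: dg; rewrite size_rcons.
by apply: cg; rewrite size_rcons.
Qed.

Lemma CnW k l g : (k <= l)%N -> Cn l g -> Cn k g.
Proof.
move=> kl [dg cg]; split=> [s j x|s] ss.
  by apply: dg; exact: leq_trans kl.
by apply: cg; exact: leq_trans kl.
Qed.

(** If the second derivative along v were negative, the first one, which vanishes
    at x, would be negative just after x, and g would decrease. *)
Lemma local_min_hessian g x (del : R) : 0 < del -> Cn 2 g ->
  (forall y, `|y - x| < del -> g x <= g y) ->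
  forall v, 0 <= \sum_i \sum_j v 0 i * v 0 j * partials [:: i; j] g x.
Proof.
move=> del0 Cg gmin v; rewrite leNgt; apply/negP => S0.
set S := \sum_i \sum_j _ in S0.
have C1 := @CnW 1 2 g isT Cg.
have grad0 i : partials [:: i] g x = 0 by apply: local_min_critical gmin; case: C1.
pose dphi t := \sum_j v 0 j * partials [:: j] g (x + t *: v).
have dphi' (t : R) : is_derive t 1 (fun u => g (x + u *: v)) (dphi t).
  exact: is_derive_line_partials.
pose N := `|v| + 1; have N0 : 0 < N by rewrite ltr_wpDl.
pose M := N * \sum_j `|v 0 j| + 1.
have M0 : 0 < M.
  by rewrite ltr_wpDl // mulr_ge0 ?(ltW N0) ?sumr_ge0.
pose e := - S / (2 * M).
have e0 : 0 < e by rewrite divr_gt0 ?mulr_gt0 // oppr_gt0.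
have [del1 del10 hd] : exists2 del1 : R, 0 < del1 & forall w, `|w| < del1 -> forall j,
    `|partials [:: j] g (x + w) - \sum_i w 0 i * partials [:: i; j] g x| <= e * `|w|.
  have H (j : 'I_n) : \forall w \near (0 : 'rV[R]_n),
    `|partials [:: j] g (x + w) - \sum_i w 0 i * partials [:: i; j] g x| <= e * `|w|.
    have [d d0 h] := partials_taylor1 x (Cn_partials j Cg) e0.
    apply/nbhs_norm0P; exists d => //= w wd.
    by have := h w wd; rewrite grad0 subr0.
  have /nbhs_norm0P[d /= d0 h] := filter_forall (nbhs_filter (0 : 'rV[R]_n)) H.
  by exists d => // w wd j; exact: h.
have neg t : 0 < t -> t * N < del1 -> dphi t < 0.
  move=> t0 tdel.
  have tv : `|t *: v| <= t * N by rewrite normrZ gtr0_norm // ler_pM2l // lerDl.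
  have tv1 : `|t *: v| < del1 by exact: le_lt_trans tdel.
  have dS : dphi t - t * S = \sum_j v 0 j * (partials [:: j] g (x + t *: v)
      - \sum_i (t *: v) 0 i * partials [:: i; j] g x).
    rewrite /dphi /S exchange_big mulr_sumr -sumrB; apply: eq_bigr => j _ /=.
    rewrite mulrBr; congr (_ - _); rewrite !mulr_sumr; apply: eq_bigr => i _.
    by rewrite mxE; ring.
  have : `|dphi t - t * S| <= e * t * M.
    rewrite dS; apply: le_trans (ler_norm_sum _ _ _) _.
    apply: le_trans (_ : \sum_j `|v 0 j| * (e * (t * N)) <= _).
      apply: ler_sum => j _; rewrite normrM ler_wpM2l //.
      by apply: le_trans (hd _ tv1 j) _; rewrite ler_pM2l.
    rewrite -mulr_suml [leLHS](_ : _ = e * t * (N * \sum_j `|v 0 j|)); last by ring.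
    by rewrite ler_wpM2l ?lerDl // mulr_ge0 // ltW.
  rewrite [e * t * M](_ : _ = - (t * S / 2)); last by rewrite /e; field; rewrite gt_eqF.
  have tS : t * S < 0 by rewrite pmulr_rlt0.
  by move=> /(le_trans (ler_norm _)); lra.
pose t := Num.min del1 del / (2 * N).
have t0 : 0 < t by rewrite divr_gt0 ?mulr_gt0 // lt_min del10.
have tN : t * N = Num.min del1 del / 2 by rewrite /t; field; rewrite gt_eqF.
have [tdel1 tdel] : t * N < del1 /\ t * N < del.
  have m1 : Num.min del1 del <= del1 by rewrite ge_min lexx.
  have m2 : Num.min del1 del <= del by rewrite ge_min lexx orbT.
  have m0 : 0 < Num.min del1 del by rewrite lt_min del10.
  by rewrite tN; split; lra.
have cont : {within `[0, t], continuous (fun u => g (x + u *: v))}.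
  by apply: derivable_within_continuous => u _; exact: ex_derive.
have [c] := @MVT _ _ dphi 0 t t0 (fun u _ => dphi' u) cont.
rewrite in_itv /= scale0r addr0 subr0 => /andP[c0 ct] E.
have : dphi c < 0 by apply: neg => //; apply: lt_trans tdel1; rewrite ltr_pM2r.
rewrite -(pmulr_llt0 _ t0) -E subr_lt0 ltNge => /negP; apply; apply: gmin.
by rewrite addrC addKr normrZ gtr0_norm // (le_lt_trans _ tdel) // ler_pM2l // lerDl.
Qed.

Lemma partials_lin k g h (a b : R) : pderivable k g -> pderivable k h ->
  forall s, (size s <= k)%N ->
    partials s (fun y => a * g y + b * h y)
      = (fun y => a * partials s g y + b * partials s h y).
Proof.
move=> dg dh; elim=> [//|i s IH] ss; apply/funext => x.
change ('D_(delta_mx 0 i) (partials s (fun y => a * g y + b * h y)) x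
  = a * 'D_(delta_mx 0 i) (partials s g) x + b * 'D_(delta_mx 0 i) (partials s h) x).
rewrite IH; last exact: ltnW.
have dgs := @derivableZ _ _ _ _ a _ _ (dg s i x ss).
have dhs := @derivableZ _ _ _ _ b _ _ (dh s i x ss).
have := deriveD dgs dhs; rewrite !deriveZ; [|exact: dh|exact: dg].
by move=> <-.
Qed.

Lemma pderivable_lin k g h (a b : R) : pderivable k g -> pderivable k h ->
  pderivable k (fun y => a * g y + b * h y).
Proof.
move=> dg dh s i x ss; rewrite (partials_lin a b dg dh (ltnW ss)).
exact: (derivableD (@derivableZ _ _ _ _ a _ _ (dg s i x ss))
  (@derivableZ _ _ _ _ b _ _ (dh s i x ss))).
Qed.

Lemma Cn_lin k g h (a b : R) : Cn k g -> Cn k h -> Cn k (fun y => a * g y + b * h y).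
Proof.
move=> [dg cg] [dh ch]; split; first exact: pderivable_lin.
move=> s ss; rewrite (partials_lin a b dg dh ss) => x.
exact: (cvgD (cvgM (cvg_cst a) (cg s ss x)) (cvgM (cvg_cst b) (ch s ss x))).
Qed.

End partial_derivatives.

(** * Comparison for weakly coupled parabolic systems *)

(** First contact: the points where some f k is nonpositive form a compact set, on
    which the time function attains its minimum. *)
Lemma finite_min_time (R : realType) (V : normedModType R) (C : set V) (N : nat)
    (f : 'I_N -> V -> R) (time : V -> R) :
  compact C -> closed C -> continuous time ->
  (forall k, {within C, continuous (f k)}) ->
  (exists2 p, C p & exists k, f k p <= 0) ->
  exists2 p, C p & (exists k, f k p <= 0) /\
    forall q, C q -> time q < time p -> forall k, 0 < f k q.
Proof.
move=> cptC clC ctime fc [p0 Cp0 bad0].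
pose B := [set p | C p /\ exists k, f k p <= 0].
have clB : closed B.
  move=> q clBq.
  have Cq : C q by apply: clC; apply: closure_subset clBq => p [].
  split=> //; apply: contrapT => /forallNP nf.
  have fq k : 0 < f k q by rewrite ltNge; apply/negP; exact: nf.
  have H k : \forall p \near q, C p -> 0 < f k p.
    have [del del0 h] := (within_continuousP _ _).1 (fc k) q Cq _ (fq k).
    apply/nbhs_normP; exists del => // p /= pq Cp.
    by have := h p Cp pq; rewrite ltr_norml => /andP[_]; lra.
  have [p [[Cp [k fkp]] hp]] := clBq _ (filter_forall (nbhs_filter q) H).
  by have := hp k Cp; rewrite ltNge fkp.
have cptB : compact B by apply: subclosed_compact clB cptC _ => p [].
have [p] := @compact_EVT_min _ _ time B (ex_intro _ p0 (conj Cp0 bad0)) cptB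
  (continuous_subspaceT ctime).
rewrite inE => -[Cp badp] pmin; exists p => //; split=> // q Cq qp k.
rewrite ltNge; apply/negP => fkq.
have := pmin q; rewrite inE leNgt qp => H.
by have : false by apply: H; split => //; exists k.
Qed.

Lemma left_min_derive_le0 (R : realType) (phi : R -> R) (t0 t : R) :
  t0 < t -> derivable phi t 1 ->
  (forall u, t0 < u < t -> phi t <= phi u) -> derive1 phi t <= 0.
Proof.
move=> t0t dphi phimin; rewrite leNgt; apply/negP => d0.
have c : h^-1 *: (phi (h + t) - phi t) @[h --> 0^'] --> derive1 phi t.
  rewrite /derive1; have := dphi; rewrite /derivable /=.
  by under eq_fun do rewrite [_%:A]mulr1.
move/cvgrPdist_lt/(_ _ d0) : c; rewrite near_withinE => /nbhs_normP[del /= del0 H].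
pose h := - (Num.min del (t - t0) / 2).
have m0 : 0 < Num.min del (t - t0) by rewrite lt_min del0 subr_gt0.
have m1 : Num.min del (t - t0) <= del by rewrite ge_min lexx.
have m2 : Num.min del (t - t0) <= t - t0 by rewrite ge_min lexx orbT.
have h0 : h < 0 by rewrite /h; lra.
have hdel : `|0 - h| < del by rewrite sub0r normrN ltr0_norm // /h; lra.
have hn0 : h != 0 by rewrite lt_eqF.
have := H h hdel hn0.
have : phi t <= phi (h + t) by apply: phimin; rewrite /h; lra.
rewrite -subr_ge0 => ph.
have : h^-1 *: (phi (h + t) - phi t) <= 0.
  by rewrite /GRing.scale /= mulr_le0_ge0 // invr_le0 ltW.
by rewrite ltr_norml => quot /andP[_]; lra.
Qed.

Section comparison.
Variables (R : realType) (d m : nat).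
Implicit Types (A : coeffs R d m) (v w z : R -> 'rV[R]_d -> 'rV[R]_m).
Implicit Types (zeta eta : 'rV[R]_d -> 'rV[R]_m).

Lemma coord_lin (X : Type) (a b : R) (zeta eta : X -> 'rV[R]_m) k :
  (fun y => (a *: zeta y + b *: eta y) 0 k) = (fun y => a * zeta y 0 k + b * eta y 0 k).
Proof. by apply/funext => y; rewrite !mxE. Qed.

Definition smooth2 zeta := forall k, Cn 2 (fun y => zeta y 0 k).

Lemma smooth2_lin (a b : R) zeta eta : smooth2 zeta -> smooth2 eta ->
  smooth2 (fun y => a *: zeta y + b *: eta y).
Proof. by move=> Z E k; rewrite coord_lin; exact: Cn_lin. Qed.

Lemma operatorE A t zeta x k : operator A t zeta x 0 k =
  \sum_i \sum_j diffusion A k t x i j * partials [:: i; j] (fun y => zeta y 0 k) x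
  + \sum_j drift A k t x 0 j * partials [:: j] (fun y => zeta y 0 k) x
  + \sum_h coupling A t x k h * zeta x 0 h.
Proof. by rewrite mxE. Qed.

Lemma operator_lin A t (a b : R) zeta eta x k : smooth2 zeta -> smooth2 eta ->
  operator A t (fun y => a *: zeta y + b *: eta y) x 0 k
  = a * operator A t zeta x 0 k + b * operator A t eta x 0 k.
Proof.
move=> /(_ k)[Z _] /(_ k)[E _].
have pE s : (size s <= 2)%N -> partials s (fun y => (a *: zeta y + b *: eta y) 0 k) x
    = a * partials s (fun y => zeta y 0 k) x + b * partials s (fun y => eta y 0 k) x.
  by move=> ss; rewrite coord_lin; exact: (congr1 (@^~ x) (partials_lin a b Z E ss)).
rewrite !operatorE !mulrDr addrACA; congr (_ + _).
  rewrite [RHS]addrACA; congr (_ + _).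
    rewrite !mulr_sumr -big_split; apply: eq_bigr => i _ /=.
    rewrite !mulr_sumr -big_split; apply: eq_bigr => j _ /=.
    by rewrite pE // mulrDr; congr (_ + _); exact: mulrCA.
  rewrite !mulr_sumr -big_split; apply: eq_bigr => j _ /=.
  by rewrite pE // mulrDr; congr (_ + _); exact: mulrCA.
rewrite !mulr_sumr -big_split; apply: eq_bigr => j _ /=.
by rewrite !mxE; ring.
Qed.

Definition regular (t0 : R) v : Prop := forall tau, t0 < tau ->
  smooth2 (v tau) /\ forall x k, derivable (fun sigma => v sigma x 0 k) tau 1.

Definition dtime v (tau : R) (x : 'rV[R]_d) (k : 'I_m) : R :=
  derive1 (fun sigma => v sigma x 0 k) tau.

Lemma regular_lin t0 (a b : R) v w : regular t0 v -> regular t0 w ->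
  regular t0 (fun tau x => a *: v tau x + b *: w tau x).
Proof.
move=> V W tau ttau; have [V2 Vt] := V _ ttau; have [W2 Wt] := W _ ttau.
split=> [|x k]; first exact: smooth2_lin.
rewrite (coord_lin a b (v ^~ x) (w ^~ x)).
by apply: derivableD; apply: derivableZ.
Qed.

Lemma dtime_lin t0 (a b : R) v w tau x k : regular t0 v -> regular t0 w -> t0 < tau ->
  dtime (fun tau x => a *: v tau x + b *: w tau x) tau x k
  = a * dtime v tau x k + b * dtime w tau x k.
Proof.
move=> V W ttau; have [_ /(_ x k) Vt] := V _ ttau; have [_ /(_ x k) Wt] := W _ ttau.
rewrite /dtime (coord_lin a b (v ^~ x) (w ^~ x)) !derive1E.
by have := deriveD (@derivableZ _ _ _ _ a _ _ Vt) (@derivableZ _ _ _ _ b _ _ Wt);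
  rewrite !deriveZ // => <-.
Qed.

Definition elliptic A (t : R) : Prop := forall k x,
  (diffusion A k t x)^T = diffusion A k t x /\ psd (diffusion A k t x).

Definition cylinder (t0 t1 : R) (x0 : 'rV[R]_d) (rho : R) : set (R * 'rV[R]_d) :=
  [set p | t0 <= p.1 <= t1 /\ `|p.2 - x0| <= rho].

Lemma closed_cylinder t0 t1 x0 rho : closed (cylinder t0 t1 x0 rho).
Proof.
rewrite (_ : cylinder _ _ _ _ = [set p | t0 <= p.1] `&` [set p | p.1 <= t1]
   `&` [set p | `|p.2 - x0| <= rho]); last first.
  by apply/seteqP; split=> p /=; [move=> [/andP[? ?] ?]|move=> [[? ?] ?]; split=> //; apply/andP].
have fst_c : continuous (@fst R 'rV[R]_d) by move=> p; exact: cvg_fst.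
have norm_c : continuous (fun p : R * 'rV[R]_d => `|p.2 - x0|).
  move=> p; apply: cvg_norm; apply: cvgB; last exact: cvg_cst.
  exact: cvg_snd.
apply: closedI; first apply: closedI.
- by apply: (@closed_comp _ _ fst [set u | t0 <= u]) => [p _|]; [exact: fst_c|exact: closed_ge].
- by apply: (@closed_comp _ _ fst [set u | u <= t1]) => [p _|]; [exact: fst_c|exact: closed_le].
- apply: (@closed_comp _ _ (fun p : R * 'rV[R]_d => `|p.2 - x0|) [set u | u <= rho]) => [p _|].
    exact: norm_c.
  exact: closed_le.
Qed.

Lemma compact_ball (x0 : 'rV[R]_d) rho : compact [set x | `|x - x0| <= rho].
Proof.
apply: bounded_closed_compact.
  exists (`|x0| + rho); split; first exact: num_real.
  move=> M lt_M x /= xx0; apply: le_trans (ltW lt_M).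
  by rewrite -[x](subrK x0) addrC (le_trans (ler_normD _ _)) // lerD2l.
have norm_c : continuous (fun x : 'rV[R]_d => `|x - x0|).
  by move=> p; exact: (cvg_norm (cvgB (@cvg_id _ (nbhs p)) (cvg_cst x0))).
apply: (@closed_comp _ _ (fun x : 'rV[R]_d => `|x - x0|) [set u | u <= rho]) => [p _|].
  exact: norm_c.
exact: closed_le.
Qed.

Lemma compact_cylinder t0 t1 x0 rho : compact (cylinder t0 t1 x0 rho).
Proof.
have -> : cylinder t0 t1 x0 rho = `[t0, t1] `*` [set x | `|x - x0| <= rho].
  by apply/seteqP; split=> p; rewrite /= in_itv.
by apply: compact_setX; [exact: segment_compact|exact: compact_ball].
Qed.

(** At the first time tau where |v_k| = z_k for some k, attained at an interior
    x, put w = z - sg v with sg the sign of v_k(tau, x). Then w_k(tau, .) is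
    nonnegative with a zero at x and w_k(., x) was positive before, so
    dtime w <= 0, although dtime w > A^P z - sg A v >= 0: the second order part
    is nonnegative at a minimum, the drift part vanishes, the diagonal zero
    order term vanishes with w_k, and each off-diagonal term is at least
    |c_kh| (z_h - |v_h|). *)
Lemma parabolic_comparison A t v z g t0 t1 x0 rho :
  elliptic A t -> regular t0 v -> regular t0 z ->
  (forall k, {within cylinder t0 t1 x0 rho, continuous (fun p => v p.1 p.2 0 k)}) ->
  (forall k, {within cylinder t0 t1 x0 rho, continuous (fun p => z p.1 p.2 0 k)}) ->
  (forall tau (x : 'rV[R]_d) k, t0 < tau <= t1 -> `|x - x0| < rho ->
     dtime v tau x k = operator A t (v tau) x 0 k + g tau x k) ->
  (forall tau (x : 'rV[R]_d) k, t0 < tau <= t1 -> `|x - x0| < rho ->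
     operator (coeffsP A) t (z tau) x 0 k + `|g tau x k| < dtime z tau x k) ->
  (forall tau (x : 'rV[R]_d) k, t0 <= tau <= t1 -> `|x - x0| <= rho ->
     tau = t0 \/ `|x - x0| = rho ->
     `|v tau x 0 k| < z tau x 0 k) ->
  forall tau (x : 'rV[R]_d) k, t0 <= tau <= t1 -> `|x - x0| <= rho -> `|v tau x 0 k| < z tau x 0 k.
Proof.
move=> ell regv regz cv cz eqv supz bnd tau1 x1 k1 tau1t x1rho.
rewrite ltNge; apply/negP => bad1.
set C := cylinder _ _ _ _ in cv cz.
pose f (k : 'I_m) (p : R * 'rV[R]_d) := z p.1 p.2 0 k - `|v p.1 p.2 0 k|.
have fc k : {within C, continuous (f k)}.
  move=> p; apply: cvgB; first exact: cz.
  by apply: cvg_norm; exact: cv.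
have [|[tau x] [/= taut xrho] [[k fk] before]] :=
    finite_min_time (@compact_cylinder t0 t1 x0 rho) (@closed_cylinder t0 t1 x0 rho)
     (fun p => @cvg_fst _ _ _ _ _) fc.
  by exists (tau1, x1) => //; exists k1; rewrite subr_le0.
have interior : t0 < tau /\ `|x - x0| < rho.
  have nb : ~ (tau = t0 \/ `|x - x0| = rho).
    move=> /(bnd tau x k taut xrho); rewrite ltNge => /negP; apply.
    by rewrite -subr_le0.
  case/andP: taut => t0tau _; split; rewrite lt_neqAle ?t0tau ?xrho andbT.
    by apply/eqP => e; apply: nb; left.
  by apply/eqP => e; apply: nb; right.
have [t0tau xint] := interior.
have tau_le : tau <= t1 by case/andP: taut.
(* By continuity from earlier times. *)
have ge0 y h : `|y - x0| <= rho -> 0 <= f h (tau, y).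
  move=> yrho; rewrite leNgt; apply/negP => fneg.
  have Cy : C (tau, y) by [].
  have fneg' : 0 < - f h (tau, y) by rewrite oppr_gt0.
  have [del del0 H] := (within_continuousP _ _).1 (fc h) _ Cy _ fneg'.
  pose u := Num.min del (tau - t0) / 2.
  have m0 : 0 < Num.min del (tau - t0) by rewrite lt_min del0 subr_gt0.
  have m1 : Num.min del (tau - t0) <= del by rewrite ge_min lexx.
  have m2 : Num.min del (tau - t0) <= tau - t0 by rewrite ge_min lexx orbT.
  have u0 : 0 < u by rewrite /u; lra.
  have Cu : C (tau - u, y) by split => //=; rewrite /u; lra.
  have := before (tau - u, y) Cu; rewrite /= gtrBl u0 => /(_ isT h).
  have : `|(tau, y) - (tau - u, y)| < del.
    rewrite prod_normE /= subrr normr0 opprB addrC subrK (gtr0_norm u0).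
    by rewrite max_l ?ltW // /u; lra.
  move=> /(H _ Cu); rewrite ltr_norml => /andP[]; lra.
have [sg [sg1 vk]] : exists sg : R, `|sg| = 1 /\ sg * v tau x 0 k = `|v tau x 0 k|.
  have [v0|v0] := leP 0 (v tau x 0 k).
    by exists 1; rewrite normr1 mul1r ger0_norm.
  by exists (- 1); rewrite normrN normr1 mulN1r ltr0_norm.
have sgle a : sg * a <= `|a| by rewrite (le_trans (ler_norm _)) // normrM sg1 mul1r.
have sgge a : - `|a| <= sg * a by rewrite lerNl -mulrN (le_trans (sgle _)) // normrN.
pose w tau x := 1 *: z tau x + (- sg) *: v tau x.
have regw : regular t0 w by exact: regular_lin.
have wE u y h : w u y 0 h = z u y 0 h - sg * v u y 0 h by rewrite !mxE mul1r mulNr.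
have w0 : w tau x 0 k = 0.
  apply/eqP; rewrite eq_le wE vk fk /=; exact: (ge0 x k xrho).
have [w2 wt] := regw _ t0tau.
have dw : dtime w tau x k <= 0.
  apply: (left_min_derive_le0 t0tau (wt x k)) => u /andP[t0u utau].
  rewrite w0 wE subr_ge0; apply: le_trans (sgle _) _; rewrite -subr_ge0 ltW //.
  by apply: (before (u, x)) => //; split => //=; rewrite ltW //= (le_trans (ltW utau)).
have wmin y : `|y - x| < rho - `|x - x0| -> w tau x 0 k <= w tau y 0 k.
  move=> yx; rewrite w0 wE subr_ge0 (le_trans (sgle _)) // -subr_ge0.
  apply: ge0; apply: ltW; rewrite -(subrK x y) -addrA.
  by apply: le_lt_trans (ler_normD _ _) _; rewrite -ltrBrDr.
have rad0 : 0 < rho - `|x - x0| by rewrite subr_gt0.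
have grad0 i : partials [:: i] (fun y => w tau y 0 k) x = 0.
  by apply: (local_min_critical i rad0 _ wmin); case: (CnW (isT : 1 <= 2)%N (w2 k)).
have hess := local_min_hessian rad0 (w2 k) wmin.
have [QT Qpsd] := ell k x.
have diff_ge0 : 0 <= \sum_i \sum_j diffusion A k t x i j
    * partials [:: i; j] (fun y => w tau y 0 k) x.
  have := @psd_contraction_ge0 _ _ _
    (\matrix_(i, j) partials [:: i; j] (fun y => w tau y 0 k) x) QT Qpsd.
  have H : psd (\matrix_(i, j) partials [:: i; j] (fun y => w tau y 0 k) x).
    move=> xi; rewrite bformE; apply: le_trans (hess xi) _.
    apply: ler_sum => i _; apply: ler_sum => j _.
    by rewrite mxE mulrC.
  move=> /(_ H) h; apply: le_trans h _; apply: ler_sum => i _; apply: ler_sum => j _.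
  by rewrite mxE.
have [v2 _] := regv _ t0tau; have [z2 _] := regz _ t0tau.
have opw : operator (coeffsP A) t (z tau) x 0 k - sg * operator A t (v tau) x 0 k
  = \sum_i \sum_j diffusion A k t x i j * partials [:: i; j] (fun y => w tau y 0 k) x
    + \sum_h (coupling (coeffsP A) t x k h * z tau x 0 h
             - sg * (coupling A t x k h * v tau x 0 h)).
  have : operator A t (w tau) x 0 k
      = \sum_i \sum_j diffusion A k t x i j * partials [:: i; j] (fun y => w tau y 0 k) x
       + \sum_h coupling A t x k h * w tau x 0 h.
    rewrite operatorE [X in _ + X + _]big1 ?addr0 // => j _.
    by rewrite grad0 mulr0.
  rewrite operator_lin // mul1r mulNr => E.
  have -> : operator (coeffsP A) t (z tau) x 0 k = operator A t (z tau) x 0 k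
     + \sum_h (coupling (coeffsP A) t x k h * z tau x 0 h
               - coupling A t x k h * z tau x 0 h).
    rewrite !operatorE /= -[RHS]addrA; congr (_ + _).
    by rewrite -big_split /=; apply: eq_bigr => h _; ring.
  rewrite [LHS]addrAC E -[LHS]addrA; congr (_ + _); rewrite -big_split /=.
  by apply: eq_bigr => h _; rewrite wE; ring.
have coup_ge0 : 0 <= \sum_h (coupling (coeffsP A) t x k h * z tau x 0 h
             - sg * (coupling A t x k h * v tau x 0 h)).
  apply: sumr_ge0 => h _; rewrite mxE; case: eqP => [->|_].
    by rewrite mulrCA -mulrBr -wE w0 mulr0.
  rewrite subr_ge0; apply: le_trans (sgle _) _; rewrite normrM ler_wpM2l //.
  by rewrite -subr_ge0; exact: ge0.
have taut' : t0 < tau <= t1 by rewrite t0tau.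
have := supz tau x k taut' xint.
move: dw; rewrite (dtime_lin _ _ x k regz regv t0tau) mul1r mulNr (eqv tau x k taut' xint).
rewrite mulrDr; have := sgle (g tau x k).
by lra.
Qed.

End comparison.

(** * Compactness, solutions and two-term barriers *)

Lemma finite_upper (R : realType) (I : finType) (P : I -> R -> Prop) :
  (forall i r r', P i r -> r <= r' -> P i r') ->
  (forall i, exists r, P i r) -> exists2 r, 0 <= r & forall i, P i r.
Proof.
move=> Pmono Pex; have [F FP] := boolp.choice Pex.
exists (\sum_i `|F i|); first by apply: sumr_ge0.
move=> i; apply: Pmono (FP i) _; apply: le_trans (ler_norm _) _.
by rewrite (bigD1 i) //= lerDl sumr_ge0.
Qed.

Lemma compact_norm_bounded (R : realType) (V W : normedModType R) (C : set V) (f : V -> W) :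
  compact C -> {within C, continuous f} ->
  exists2 N : R, 0 <= N & forall p, C p -> `|f p| <= N.
Proof.
move=> cC fc; have bf := compact_bounded (continuous_compact fc cC).
have [N [_ hN]] := bf; exists `|N + 1| => // p Cp; apply: le_trans (ler_norm _).
by apply: (hN (N + 1)); [rewrite ltrDl|exists p].
Qed.

(** Heine: minimise |x - y| over the pairs of points of C whose images are at
    distance at least eps. *)
Lemma compact_unif_cont (R : realType) (V W : normedModType R) (C : set V) (f : V -> W)
    (eps : R) : compact C -> closed C -> continuous f -> 0 < eps ->
  exists2 rho : R, 0 < rho &
    forall x y, C x -> C y -> `|x - y| < rho -> `|f x - f y| < eps.
Proof.
move=> cC clC fc eps0.
pose F (k : 'I_1) (p : V * V) := eps - `|f p.1 - f p.2|.
have [bad|nobad] := pselect (exists2 p, (C `*` C) p & exists k, F k p <= 0).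
  have clCC : closed (C `*` C) .
    rewrite (_ : _ `*` _ = fst @^-1` C `&` snd @^-1` C) //.
    by apply: closedI; apply: closed_comp => // p _; [exact: cvg_fst|exact: cvg_snd].
  have ctime : continuous (fun p : V * V => `|p.1 - p.2|).
    by move=> p; apply: cvg_norm; apply: cvgB; [exact: cvg_fst|exact: cvg_snd].
  have Fc k : {within C `*` C, continuous (F k)}.
    apply: continuous_subspaceT => p; apply: cvgB; first exact: cvg_cst.
    apply: cvg_norm; apply: cvgB.
      by apply: (cvg_comp _ _ cvg_fst); exact: fc.
    by apply: (cvg_comp _ _ cvg_snd); exact: fc.
  have [p [Cp1 Cp2] [[k Fk] before]] :=
    finite_min_time (compact_setX cC cC) clCC ctime Fc bad.
  exists `|p.1 - p.2|.
    rewrite normr_gt0 subr_eq0; apply/eqP => e; move: Fk.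
    by rewrite /F e subrr normr0 subr0 leNgt eps0.
  move=> x y Cx Cy xy; rewrite -subr_gt0.
  exact: (before (x, y) _ xy ord0).
exists 1 => // x y Cx Cy _; rewrite -subr_gt0 ltNge; apply/negP => h.
by apply: nobad; exists (x, y) => //; exists ord0.
Qed.

Section solutions.
Variables (R : realType) (d m : nat).
Implicit Types (A : coeffs R d m) (v w z : R -> 'rV[R]_d -> 'rV[R]_m).
Implicit Types (zeta eta : 'rV[R]_d -> 'rV[R]_m).

(** The infimum over an unbounded spectrum would be the default value 0, which
    positivity of mu excludes; so the infimum bounds each eigenvalue below. *)
Lemma elliptic_of_cond alpha (I : set R) A t :
  cond_i alpha I A -> cond_ii I A -> I t -> elliptic A t.
Proof.
move=> [Asym _] Aii It k x; split; first exact: Asym.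
apply: psd_of_eigenvalues => [|l evl]; first exact: Asym.
have J : bounded_subinterval I [set t].
  split=> [a b -> -> c|| _ ->] //.
    by move=> /andP[? ?]; apply/eqP; rewrite eq_le; apply/andP.
  by apply: compact_bounded; exact: compact_set1.
have := Aii [set t] k J.
have /ereal_inf_lbound : [set (mu A k p.1 p.2)%:E | p in [set t] `*` [set: 'rV[R]_d]]
    (mu A k t x)%:E by exists (t, x).
move=> /[swap] /lt_le_trans/[apply]; rewrite lte_fin /mu /min_eigenvalue => mu0.
have [hinf|/inf_out h] := pselect (has_inf [set l | eigenvalue (diffusion A k t x) l]).
  by rewrite ltW // (lt_le_trans mu0) //; apply: ge_inf => //; case: hinf.
by rewrite h ltxx in mu0.
Qed.

Section given_solution.
Variables (A : coeffs R d m) (t : R) (f : 'rV[R]_d -> 'rV[R]_m).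
Variable u : R -> 'rV[R]_d -> 'rV[R]_m.
Hypothesis hu : bounded_classical_solution A t f u.

Lemma solution_smooth2 tau : 0 < tau -> smooth2 (u tau).
Proof.
move=> tau0 k; case: hu => _ _ /(_ k)[uk uc] _ _; split; first exact: uk.
move=> s ss; apply: continuous_of_dist => x e e0.
have [del del0 h] := (within_continuousP _ _).1 (uc s ss) (tau, x) tau0 e e0.
exists del => // y xy.
by apply: (h (tau, y)) => //; rewrite prod_normE /= subrr normr0 max_r.
Qed.

Lemma solution_regular : regular 0 u.
Proof.
move=> tau tau0; split=> [|x k]; first exact: solution_smooth2.
by case: hu => _ [/(_ tau x tau0) /derivable_mxP ? _] _ _ _.
Qed.

Lemma solution_dtime tau x k : 0 < tau ->
  dtime u tau x k = operator A t (u tau) x 0 k.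
Proof.
move=> tau0; case: hu => _ [/(_ tau x tau0) du _] _ [/(_ tau x tau0) <- _] _.
by rewrite /dtime !derive1E derive_mx // mxE.
Qed.

Lemma solution_continuous (D : set (R * 'rV[R]_d)) k :
  (forall p, D p -> 0 <= p.1) -> {within D, continuous (fun p => u p.1 p.2 0 k)}.
Proof.
move=> Dpos; case: hu => uc _ _ _ _.
apply/within_continuousP => p Dp e e0.
have [del del0 h] := (within_continuousP _ _).1 uc p (Dpos p Dp) e e0.
exists del => // q Dq pq; apply: le_lt_trans (h q (Dpos q Dq) pq).
have -> : u p.1 p.2 0 k - u q.1 q.2 0 k = (u p.1 p.2 - u q.1 q.2) 0 k by rewrite !mxE.
exact: rV_norm_coord.
Qed.

Lemma solution_partials_continuous (D : set (R * 'rV[R]_d)) k s :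
  (forall p, D p -> 0 < p.1) -> (size s <= 2)%N ->
  {within D, continuous (fun p => partials s (fun y => u p.1 y 0 k) p.2)}.
Proof.
move=> Dpos ss; case: hu => _ _ /(_ k)[_ /(_ s ss) uc] _ _.
apply/within_continuousP => p Dp e e0.
have [del del0 h] := (within_continuousP _ _).1 uc p (Dpos p Dp) e e0.
by exists del => // q Dq; apply: h; exact: Dpos.
Qed.

Lemma solution_init x : u 0 x = f x.
Proof. by case: hu => _ _ _ [_ ->]. Qed.

Lemma solution_bounded (T : R) :
  exists N, forall tau x k, 0 <= tau <= T -> `|u tau x 0 k| <= N.
Proof.
case: hu => _ _ _ _ /(_ T) [N [_ hN]].
exists (N + 1) => tau x k tauT; apply: le_trans (rV_norm_coord _ _) _.
by apply: (hN (N + 1) _ (tau, x)) => //; rewrite ltrDl.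
Qed.

End given_solution.

(** Each barrier used below is a sum of two products of a function of time and a
    function of space. *)
Definition two_term (al be : R -> R) zeta eta : R -> 'rV[R]_d -> 'rV[R]_m :=
  fun tau x => al tau *: zeta x + be tau *: eta x.

Lemma two_termE al be zeta eta tau x k :
  two_term al be zeta eta tau x 0 k = al tau * zeta x 0 k + be tau * eta x 0 k.
Proof. by rewrite !mxE. Qed.

Section two_term.
Variables (al be dal dbe : R -> R) (zeta eta : 'rV[R]_d -> 'rV[R]_m).
Hypothesis dalP : forall tau : R, is_derive tau 1 al (dal tau).
Hypothesis dbeP : forall tau : R, is_derive tau 1 be (dbe tau).
Hypotheses (zeta2 : smooth2 zeta) (eta2 : smooth2 eta).

Let two_term_derive (tau : R) x k :
  is_derive tau 1 (fun sigma => two_term al be zeta eta sigma x 0 k)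
  (dal tau * zeta x 0 k + dbe tau * eta x 0 k).
Proof.
have -> : (fun sigma => two_term al be zeta eta sigma x 0 k)
    = (zeta x 0 k \*: al) + (eta x 0 k \*: be).
  by apply/funext => sigma; rewrite two_termE [al _ * _]mulrC [be _ * _]mulrC.
apply: is_derive_eq.
by rewrite [dal _ * _]mulrC [dbe _ * _]mulrC.
Qed.

Lemma two_term_regular t0 : regular t0 (two_term al be zeta eta).
Proof.
move=> tau _; split=> [|x k]; first exact: smooth2_lin.
by have [] := two_term_derive tau x k.
Qed.

Lemma two_term_dtime tau x k : dtime (two_term al be zeta eta) tau x k
  = dal tau * zeta x 0 k + dbe tau * eta x 0 k.
Proof. by rewrite /dtime derive1E; have [] := two_term_derive tau x k. Qed.

Lemma two_term_continuous (D : set (R * 'rV[R]_d)) k :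
  {within D, continuous (fun p => two_term al be zeta eta p.1 p.2 0 k)}.
Proof.
apply: continuous_subspaceT => p.
under eq_fun do rewrite two_termE.
have cR (a : R -> R) (da : R -> R) : (forall tau : R, is_derive tau 1 a (da tau)) ->
    a q.1 @[q --> p] --> a p.1.
  move=> dP; apply: (cvg_comp _ _ cvg_fst).
  apply: (@differentiable_continuous _ _ _ p.1 a); apply/derivable1_diffP.
  by have [] := dP p.1.
have cV xi : smooth2 xi -> xi q.2 0 k @[q --> p] --> xi p.2 0 k.
  move=> /(_ k)[_ /(_ [::] isT p.2) c].
  exact: (@cvg_comp _ _ _ snd (fun y => xi y 0 k) _ _ _ cvg_snd c).
exact: (cvgD (cvgM (cR _ _ dalP) (cV _ zeta2)) (cvgM (cR _ _ dbeP) (cV _ eta2))).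
Qed.

Lemma two_term_operator A t tau x k :
  operator A t (two_term al be zeta eta tau) x 0 k
  = al tau * operator A t zeta x 0 k + be tau * operator A t eta x 0 k.
Proof. exact: operator_lin. Qed.

End two_term.

Lemma is_derive_exp (a kappa t0 tau : R) :
  is_derive tau 1 (fun sigma => a * expR (kappa * (sigma - t0)))
    (kappa * (a * expR (kappa * (tau - t0)))).
Proof.
apply: is_derive_eq.
by rewrite /GRing.scale /=; ring.
Qed.

End solutions.

(** * Barriers on large balls *)

Section explicit_functions.
Variables (R : realType) (d : nat).
Implicit Types (x : 'rV[R]_d).

Lemma partials_cst (c : R) i (s : seq 'I_d) : partials (i :: s) (fun=> c) = (fun=> 0).
Proof.
elim: s i => [|j s IH] i; apply/funext => x.
  exact: (@derive_cst _ _ _ c x (delta_mx 0 i)).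
change ('D_(delta_mx 0 i) (partials (j :: s) (fun=> c)) x = 0).
by rewrite IH; exact: (@derive_cst _ _ _ 0 x (delta_mx 0 i)).
Qed.

Lemma Cn_cst k (c : R) : Cn k (fun _ : 'rV[R]_d => c).
Proof.
have pc s : exists c', partials s (fun _ : 'rV[R]_d => c) = (fun=> c').
  by case: s => [|i s]; [exists c|exists 0; rewrite partials_cst].
split=> [s i x _|s _]; have [c' ->] := pc s; first exact: derivable_cst.
exact: cst_continuous.
Qed.

Definition sqdist (x0 x : 'rV[R]_d) : R := \sum_j (x 0 j - x0 0 j) ^+ 2.

Lemma sqdist_ge0 x0 x : 0 <= sqdist x0 x.
Proof. by apply: sumr_ge0 => j _; exact: sqr_ge0. Qed.

Lemma sqdistxx x0 : sqdist x0 x0 = 0.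
Proof. by apply: big1 => j _; rewrite subrr expr0n. Qed.

Lemma sqdist_le x0 x : `|x - x0| <= 1 -> sqdist x0 x <= d%:R.
Proof.
move=> xx0; have -> : d%:R = \sum_(j < d) (1 : R) by rewrite sumr_const card_ord.
apply: ler_sum => j _; rewrite -real_normK ?num_real // expr_le1 //.
by apply: le_trans xx0; have := rV_norm_coord (x - x0) j; rewrite !mxE.
Qed.

Lemma sqdist_ge x0 x (r : R) : 0 <= r -> r <= `|x - x0| -> r ^+ 2 <= sqdist x0 x.
Proof.
move=> r0 rx; have [->|rn0] := eqVneq r 0; first by rewrite expr0n sqdist_ge0.
have [j rj] : exists j, r <= `|(x - x0) 0 j|.
  have n0 : mx_norm (x - x0) != 0.
    by rewrite gt_eqF // (lt_le_trans _ rx) // lt_def rn0.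
  have [[i j] /= e] := mx_norm_neq0 n0; exists j.
  by apply: le_trans rx _; rewrite [`|x - x0|]e ord1.
rewrite /sqdist (bigD1 j) //=; apply: ler_wpDr.
  by apply: sumr_ge0 => i _; exact: sqr_ge0.
by rewrite -[leRHS]real_normK ?num_real // ler_pXn2r ?nnegrE //; move: rj; rewrite !mxE.
Qed.

Lemma is_derive_coord x v j : is_derive x v (fun y : 'rV[R]_d => y 0 j) (v 0 j).
Proof.
have l : (fun h : R => h^-1 *: (((fun y : 'rV[R]_d => y 0 j) \o shift x) (h *: v) - x 0 j))
    @ 0^' --> v 0 j.
  apply: cvg_near_cst; rewrite near_withinE; near=> h => h0.
  by rewrite /= !mxE addrK /GRing.scale /= mulrA mulVf // mul1r.
by split; [apply/cvg_ex; eexists; exact: l|exact/cvg_lim].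
Unshelve. all: by end_near. Qed.

Lemma partials_sqdist1 x0 i :
  partials [:: i] (sqdist x0) = (fun x => 2 * (x 0 i - x0 0 i))
  /\ forall x, derivable (sqdist x0) x (delta_mx 0 i).
Proof.
have D x : is_derive x (delta_mx 0 i) (sqdist x0) (2 * (x 0 i - x0 0 i)).
  have -> : sqdist x0 = \sum_(j < d) ((fun y : 'rV[R]_d => y 0 j) - cst (x0 0 j)) ^+ 2.
    by apply/funext => y; rewrite fct_sumE /sqdist; apply: eq_bigr.
  have Dj j : is_derive x (delta_mx 0 i) (((fun y : 'rV[R]_d => y 0 j) - cst (x0 0 j)) ^+ 2)
      (2 * (x 0 j - x0 0 j) * (i == j)%:R).
    have := is_derive_coord x (delta_mx 0 i) j; rewrite mxE eqxx /= eq_sym => Dc.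
    by apply: is_derive_eq; rewrite subr0 -[LHS]/(2 * (x 0 j - x0 0 j) ^+ 1 * (i == j)%:R) expr1.
  apply: is_derive_eq; rewrite (bigD1 i) //= eqxx mulr1 big1 ?addr0 // => j ji.
  by rewrite eq_sym (negbTE ji) mulr0.
split=> [|x]; last by have [] := D x.
by apply/funext => x; have [_] := D x.
Qed.

Lemma partials_sqdist2 x0 i j :
  partials [:: i; j] (sqdist x0) = (fun=> 2 * (i == j)%:R)
  /\ forall x, derivable (partials [:: j] (sqdist x0)) x (delta_mx 0 i).
Proof.
have D x : is_derive x (delta_mx 0 i) (partials [:: j] (sqdist x0)) (2 * (i == j)%:R).
  have -> : partials [:: j] (sqdist x0)
      = 2 \*: ((fun y : 'rV[R]_d => y 0 j) - cst (x0 0 j)).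
    by rewrite (partials_sqdist1 x0 j).1.
  have := is_derive_coord x (delta_mx 0 i) j; rewrite mxE eqxx /= eq_sym => Dc.
  by apply: is_derive_eq; rewrite subr0.
split=> [|x]; last by have [] := D x.
by apply/funext => x; have [_] := D x.
Qed.

Lemma Cn_sqdist x0 : Cn 2 (sqdist x0).
Proof.
have cc j : continuous (fun y : 'rV[R]_d => y 0 j) by move=> y; exact: coord_continuous.
split=> [[|i [|//]] j x _|[|i [|j [|//]]] _].
- exact: (partials_sqdist1 x0 j).2.
- exact: (partials_sqdist2 x0 j i).2.
- move=> x; apply: (@cvg_sum_fin _ _ (nbhs x)) => j.
  rewrite expr2.
  exact: (cvgM (cvgB (cc j x) (cvg_cst (x0 0 j))) (cvgB (cc j x) (cvg_cst (x0 0 j)))).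
- rewrite (partials_sqdist1 x0 i).1 => x.
  exact: (cvgM (cvg_cst (2 : R)) (cvgB (cc i x) (cvg_cst (x0 0 i)))).
- by rewrite (partials_sqdist2 x0 i j).1; exact: cst_continuous.
Qed.

End explicit_functions.

Section barriers.
Variables (R : realType) (d m : nat).
Implicit Types (A : coeffs R d m) (v w z : R -> 'rV[R]_d -> 'rV[R]_m).
Implicit Types (zeta eta : 'rV[R]_d -> 'rV[R]_m).

Definition diagonal (h : 'rV[R]_d -> R) : 'rV[R]_d -> 'rV[R]_m := fun x => const_mx (h x).

Lemma diagonalE h k : (fun y => diagonal h y 0 k) = h.
Proof. by apply/funext => y; rewrite mxE. Qed.

Lemma smooth2_diagonal h : Cn 2 h -> smooth2 (diagonal h).
Proof. by move=> Ch k; rewrite diagonalE. Qed.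

Lemma operator_diagonal A t h x k : operator A t (diagonal h) x 0 k =
  \sum_i \sum_j diffusion A k t x i j * partials [:: i; j] h x
  + \sum_j drift A k t x 0 j * partials [:: j] h x
  + (\sum_h coupling A t x k h) * h x.
Proof.
by rewrite operatorE diagonalE mulr_suml; congr (_ + _); apply: eq_bigr => l _; rewrite mxE.
Qed.

Lemma operator_diagonal_cst A t x k :
  operator (coeffsP A) t (diagonal (fun=> 1)) x 0 k = rowsumP A k t x.
Proof.
rewrite operator_diagonal mulr1.
have -> : \sum_i \sum_j diffusion A k t x i j * partials [:: i; j] (fun=> 1) x = 0.
  by apply: big1 => i _; apply: big1 => j _; rewrite partials_cst mulr0.
have -> : \sum_j drift A k t x 0 j * partials [:: j] (fun=> 1) x = 0.
  by apply: big1 => j _; rewrite partials_cst mulr0.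
by rewrite !add0r.
Qed.

Definition lyapunov A t (phi : 'rV[R]_d -> 'rV[R]_m) (lam : R) : Prop :=
  [/\ smooth2 phi, forall x k, 0 < phi x 0 k, 0 < lam,
      forall x k, operator (coeffsP A) t phi x 0 k <= lam * phi x 0 k &
      forall M : R, exists2 r, 0 <= r & forall x k, r <= `|x| -> M < phi x 0 k].

(** The barrier z = a e^((lam + 1)(tau - t0)) phi satisfies z_tau >= A^P z + z,
    and the gain z >= a phi absorbs the source. *)
Lemma lyapunov_barrier A t phi lam v g t0 t1 rho a :
  elliptic A t -> lyapunov A t phi lam -> 0 < a -> regular t0 v ->
  (forall k, {within cylinder t0 t1 0 rho, continuous (fun p => v p.1 p.2 0 k)}) ->
  (forall tau (x : 'rV[R]_d) k, t0 < tau <= t1 -> `|x| < rho ->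
     dtime v tau x k = operator A t (v tau) x 0 k + g tau x k) ->
  (forall tau (x : 'rV[R]_d) k, t0 < tau <= t1 -> `|x| < rho -> `|g tau x k| < a * phi x 0 k) ->
  (forall (x : 'rV[R]_d) k, `|x| <= rho -> `|v t0 x 0 k| < a * phi x 0 k) ->
  (forall tau (x : 'rV[R]_d) k, t0 <= tau <= t1 -> `|x| = rho -> `|v tau x 0 k| < a * phi x 0 k) ->
  forall tau (x : 'rV[R]_d) k, t0 <= tau <= t1 -> `|x| <= rho ->
    `|v tau x 0 k| < a * expR ((lam + 1) * (tau - t0)) * phi x 0 k.
Proof.
move=> ell [phi2 phi0 lam0 supphi _] a0 regv cv eqv gsmall vinit vlat tau x k taut xrho.
pose al tau := a * expR ((lam + 1) * (tau - t0)).
have dal (sigma : R) : is_derive sigma 1 al ((lam + 1) * al sigma).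
  exact: is_derive_exp.
have d0 (sigma : R) : is_derive sigma 1 (fun _ : R => (0 : R)) 0 by exact: is_derive_cst.
have lam1 : 0 < lam + 1 by rewrite addr_gt0.
have al_ge sigma : t0 <= sigma -> a <= al sigma.
  move=> s0; rewrite /al ler_peMr ?(ltW a0) //.
  by rewrite -[leLHS]expR0 ler_expR mulr_ge0 ?subr_ge0 ?(ltW lam1).
have cz l : {within cylinder t0 t1 0 rho,
    continuous (fun p => two_term al (fun=> 0) phi phi p.1 p.2 0 l)}.
  exact: (@two_term_continuous _ _ _ _ _ _ _ _ _ dal d0 phi2 phi2 _ l).
have regz := @two_term_regular _ _ _ _ _ _ _ _ _ dal d0 phi2 phi2 t0.
have := parabolic_comparison (g := g) ell regv regz cv cz.
rewrite -[a * _]/(al tau).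
have -> : al tau * phi x 0 k = two_term al (fun=> 0) phi phi tau x 0 k.
  by rewrite two_termE mul0r addr0.
apply; rewrite ?subr0 //.
- by move=> s y l sT; rewrite subr0; exact: eqv.
- move=> s y l /[dup] sT /andP[s0 _]; rewrite subr0 => yr.
  rewrite two_term_operator // (two_term_dtime _ _ dal d0) !mul0r !addr0.
  have gs := gsmall s y l sT yr.
  have := supphi y l; have := al_ge s (ltW s0); have := phi0 y l.
  set p := phi y 0 l in gs *; set o := operator _ _ _ _ _ _ => p0 ale sup.
  have al0 : 0 < al s by apply: lt_le_trans ale.
  have h1 : al s * o <= al s * (lam * p) by rewrite ler_pM2l.
  have h2 : a * p <= al s * p by rewrite ler_pM2r.
  by rewrite (_ : (lam + 1) * al s * p = al s * (lam * p) + al s * p); [lra|ring].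
- move=> s y l sT; rewrite subr0 => yr bnd; rewrite two_termE mul0r addr0.
  apply: lt_le_trans (_ : a * phi y 0 l <= _).
    by case: bnd => [->|yrho]; [exact: vinit|exact: vlat].
  by rewrite ler_pM2r //; apply: al_ge; case/andP: sT.
Qed.

(** Compare with F e^(kappa tau) + eps e^((lam + 1) tau) phi. The second term is
    there to dominate the bounded function u on a sphere of large radius; it is
    removed by letting eps tend to 0. *)
Lemma solution_sup_bound A t f u phi lam kappa F :
  elliptic A t -> lyapunov A t phi lam -> (forall x k, rowsumP A k t x <= kappa) ->
  bounded_classical_solution A t f u -> 0 <= F -> (forall x k, `|f x 0 k| <= F) ->
  forall tau x k, 0 <= tau -> `|u tau x 0 k| <= F * expR (kappa * tau).
Proof.
move=> ell [phi2 phi0 lam0 supphi phiinf] row hu F0 fF tau1 x1 k1 tau1_0.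
apply/ler_addgt0Pr => eta eta0.
have E0 : 0 < expR ((lam + 1) * (tau1 - 0)) * phi x1 0 k1 by rewrite mulr_gt0 ?expR_gt0.
pose eps := eta / (expR ((lam + 1) * (tau1 - 0)) * phi x1 0 k1).
have eps0 : 0 < eps by rewrite divr_gt0.
have [N uN] := solution_bounded hu tau1.
have [r r0 hr] := phiinf (N / eps).
pose rho := Num.max r `|x1|.
pose al tau := F * expR (kappa * (tau - 0)).
pose be tau := eps * expR ((lam + 1) * (tau - 0)).
have dal (sigma : R) : is_derive sigma 1 al (kappa * al sigma) by exact: is_derive_exp.
have dbe (sigma : R) : is_derive sigma 1 be ((lam + 1) * be sigma) by exact: is_derive_exp.
have one2 : smooth2 (diagonal (fun=> 1)) by apply: smooth2_diagonal; exact: Cn_cst.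
have al0 tau : 0 <= al tau by rewrite mulr_ge0 ?expR_ge0.
have be0 tau : 0 < be tau by rewrite mulr_gt0 ?expR_gt0.
have cu l : {within cylinder 0 tau1 0 rho, continuous (fun p => u p.1 p.2 0 l)}.
  by apply: (solution_continuous hu) => p [/andP[]].
have cz l : {within cylinder 0 tau1 0 rho,
    continuous (fun p => two_term al be (diagonal (fun=> 1)) phi p.1 p.2 0 l)}.
  exact: (@two_term_continuous _ _ _ _ _ _ _ _ _ dal dbe one2 phi2 _ l).
have regz := @two_term_regular _ _ _ _ _ _ _ _ _ dal dbe one2 phi2 0.
have := parabolic_comparison (g := fun _ _ _ => 0) ell (solution_regular hu) regz cu cz.
have -> : F * expR (kappa * tau1) + eta = two_term al be (diagonal (fun=> 1)) phi tau1 x1 0 k1.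
  rewrite two_termE mxE mulr1 /al subr0; congr (_ + _).
  by rewrite /be -mulrA /eps divfK // gt_eqF.
move=> H; apply: ltW; apply: H.
- by move=> tau x k /andP[tau0 _] _; rewrite addr0; exact: solution_dtime hu _ _ _ tau0.
- move=> tau x k /andP[tau0 _] _.
  rewrite normr0 addr0 two_term_operator // (two_term_dtime _ _ dal dbe).
  rewrite operator_diagonal_cst [diagonal _ _ _ _]mxE mulr1.
  have h1 : al tau * rowsumP A k t x <= kappa * al tau by rewrite mulrC ler_wpM2r.
  have h2 : be tau * operator (coeffsP A) t phi x 0 k < (lam + 1) * be tau * phi x 0 k.
    rewrite -mulrA mulrCA ltr_pM2l // (le_lt_trans (supphi x k)) //.
    by rewrite mulrDl mul1r ltrDl.
  exact: ler_ltD.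
- move=> tau x k taut; rewrite subr0 => xr bnd; rewrite two_termE mxE mulr1.
  case: bnd => [tau0|xrho].
    rewrite tau0 (solution_init hu) /al subr0 mulr0 expR0 mulr1.
    by rewrite (le_lt_trans (fF x k)) // ltrDl mulr_gt0.
  have := hr x k; rewrite xrho /rho le_max lexx => /(_ isT).
  rewrite ltr_pdivrMr // => Nphi.
  apply: le_lt_trans (uN tau x k taut) _.
  apply: lt_le_trans Nphi _; rewrite mulrC -[leLHS]add0r lerD // ler_pM2r // /be.
  rewrite ler_peMr ?(ltW eps0) // -[leLHS]expR0 ler_expR mulr_ge0 ?subr0 //.
    by rewrite addr_ge0 // ltW.
  by case/andP: taut.
- by rewrite tau1_0 lexx.
- by rewrite subr0 /rho le_max lexx orbT.
Qed.

End barriers.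

Arguments diagonal {R d m} h x.

(** * Behaviour for small times *)

Section small_time.
Variables (R : realType) (d m : nat).
Implicit Types (A : coeffs R d m).

Definition coeffs_bounded_on A (t : R) (C : set 'rV[R]_d) (L : R) : Prop :=
  forall x k, C x -> [/\ forall i j, `|diffusion A k t x i j| <= L,
    forall j, `|drift A k t x 0 j| <= L & forall h, `|coupling A t x k h| <= L].

(** A strict upper bound, as long as rate * tau <= 1, for A^P applied to the
    barrier of solution_small_time plus the source A(f x0); the term 4 d L comes
    from the derivatives of |x - x0|^2. *)
Definition small_time_rate (L M K eps : R) : R :=
  m%:R * L * M + (2 * eps + 1) * (m%:R * L) + K * (4 * d%:R * L + m%:R * L * d%:R) + 1.

Lemma small_time_rate_ge1 (L M K eps : R) :
  0 < eps -> 0 <= K -> 0 <= L -> 0 <= M -> 1 <= small_time_rate L M K eps.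
Proof.
move=> eps0 K0 L0 M0; rewrite /small_time_rate lerDr !addr_ge0 //.
- by rewrite !mulr_ge0.
- by rewrite !mulr_ge0 // addr_ge0 // mulr_ge0 // ltW.
- by rewrite mulr_ge0 // addr_ge0 // !mulr_ge0.
Qed.

Lemma regular_cst t0 (c : 'rV[R]_m) : regular t0 (fun _ (_ : 'rV[R]_d) => c).
Proof. by move=> tau _; split=> [k|x k]; [exact: Cn_cst|exact: derivable_cst]. Qed.

Lemma operator_cst A t (c : 'rV[R]_m) x k :
  operator A t (fun=> c) x 0 k = \sum_h coupling A t x k h * c 0 h.
Proof.
rewrite operatorE.
have -> : \sum_i \sum_j diffusion A k t x i j * partials [:: i; j] (fun=> c 0 k) x = 0.
  by apply: big1 => i _; apply: big1 => j _; rewrite partials_cst mulr0.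
have -> : \sum_j drift A k t x 0 j * partials [:: j] (fun=> c 0 k) x = 0.
  by apply: big1 => j _; rewrite partials_cst mulr0.
by rewrite !add0r.
Qed.

Lemma sum_norm_le (I : finType) (F : I -> R) (N : R) :
  (forall i, `|F i| <= N) -> `|\sum_i F i| <= #|I|%:R * N.
Proof.
move=> FN; apply: le_trans (ler_norm_sum _ _ _) _.
apply: le_trans (ler_sum _ (fun i _ => FN i)) _.
by rewrite sumr_const mulr_natl.
Qed.

(** On the unit ball around x0, u - f(x0) solves the equation with source A(f x0)
    and is compared with 2 eps + K |x - x0|^2 + rate * tau: this dominates
    initially by the bound on the oscillation of f, and on the unit sphere
    because K >= 2 M. *)
Lemma solution_small_time A (t : R) f u (x0 : 'rV[R]_d) (L M K eps : R) :
  elliptic A t -> bounded_classical_solution A t f u ->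
  0 < eps -> 0 <= K -> 0 <= L -> 0 <= M ->
  coeffs_bounded_on A t [set x | `|x - x0| <= 1] L ->
  (forall (tau : R) x k, 0 <= tau <= 1 -> `|u tau x 0 k| <= M) -> 2 * M <= K ->
  (forall (x : 'rV[R]_d) k, `|x - x0| <= 1 -> `|f x 0 k - f x0 0 k| <= eps + K * sqdist x0 x) ->
  forall (tau : R) k, 0 <= tau <= 1 -> small_time_rate L M K eps * tau <= 1 ->
    `|u tau x0 0 k - f x0 0 k| <= 2 * eps + small_time_rate L M K eps * tau.
Proof.
move=> ell hu eps0 K0 L0 M0 coefL uM MK fosc tau1 k1 tau1_01 rate_tau1.
set rate := small_time_rate L M K eps in rate_tau1 *.
have rate1 : 1 <= rate by exact: small_time_rate_ge1.
have fM k : `|f x0 0 k| <= M.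
  by rewrite -(solution_init hu x0); apply: uM; rewrite lexx ler01.
pose v (tau : R) x := 1 *: u tau x + (-1) *: (fun=> f x0) x.
have vE tau x k : v tau x 0 k = u tau x 0 k - f x0 0 k by rewrite !mxE mul1r mulN1r.
have regu := solution_regular hu.
have regv : regular 0 v by apply: regular_lin regu _; exact: regular_cst.
pose al tau := 2 * eps + rate * tau.
have dal (sigma : R) : is_derive sigma 1 al rate.
  have -> : al = cst (2 * eps) + rate \*: id by [].
  by apply: is_derive_eq; rewrite add0r [_ *: 1]mulr1.
have dbe (sigma : R) : is_derive sigma 1 (fun _ : R => K) 0 by exact: is_derive_cst.
have one2 : smooth2 (@diagonal R d m (fun=> 1)) by apply: smooth2_diagonal; exact: Cn_cst.
have sq2 : smooth2 (@diagonal R d m (sqdist x0)) by apply: smooth2_diagonal; exact: Cn_sqdist.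
pose z := two_term al (fun=> K) (@diagonal R d m (fun=> 1)) (diagonal (sqdist x0)).
have zE tau x k : z tau x 0 k = al tau + K * sqdist x0 x.
  by rewrite two_termE !mxE mulr1.
have cu l : {within cylinder 0 tau1 x0 1, continuous (fun p => u p.1 p.2 0 l)}.
  by apply: (solution_continuous hu) => p [/andP[]].
have cv l : {within cylinder 0 tau1 x0 1, continuous (fun p => v p.1 p.2 0 l)}.
  under eq_fun do rewrite vE.
  by move=> p; apply: cvgB; [exact: cu|exact: cvg_cst].
have cz l : {within cylinder 0 tau1 x0 1, continuous (fun p => z p.1 p.2 0 l)}.
  exact: (@two_term_continuous _ _ _ _ _ _ _ _ _ dal dbe one2 sq2 _ l).
have regz := @two_term_regular _ _ _ _ _ _ _ _ _ dal dbe one2 sq2 0.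
pose g (tau : R) x k := \sum_h coupling A t x k h * f x0 0 h.
have tau1_le1 : tau1 <= 1 by case/andP: tau1_01.
have x0_in : `|x0 - x0| <= 1 by rewrite subrr normr0.
suff : `|v tau1 x0 0 k1| < z tau1 x0 0 k1.
  by rewrite vE zE sqdistxx mulr0 addr0 => /ltW.
apply: (@parabolic_comparison _ _ _ A t v z g 0 tau1 x0 1) => //.
- move=> tau x k /andP[tau0 _] _.
  rewrite (dtime_lin _ _ _ _ regu (@regular_cst 0 (f x0)) tau0).
  rewrite operator_lin; [|exact: (regu _ tau0).1|exact: (@regular_cst 0 (f x0) _ tau0).1].
  have -> : dtime (fun _ _ => f x0) tau x k = 0 by rewrite /dtime derive1E derive_cst.
  by rewrite (solution_dtime hu) // operator_cst -/(g tau x k); ring.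
- move=> tau x k /andP[tau0 taut] xr1; have xr := ltW xr1.
  have [qL bL cL] := coefL x k xr.
  rewrite two_term_operator // (two_term_dtime _ _ dal dbe).
  rewrite mul0r addr0 [diagonal _ _ _ _]mxE mulr1.
  have gM : `|g tau x k| <= m%:R * L * M.
    have := @sum_norm_le _ (fun h => coupling A t x k h * f x0 0 h) (L * M).
    rewrite card_ord mulrA; apply=> h.
    by rewrite normrM ler_pM.
  have rowL : `|rowsumP A k t x| <= m%:R * L.
    have := @sum_norm_le _ (fun h => coupling (coeffsP A) t x k h) L.
    by rewrite card_ord; apply=> h; rewrite mxE; case: ifP => _; rewrite ?normr_id.
  have sqL : sqdist x0 x <= d%:R := sqdist_le xr.
  have xj j : `|x 0 j - x0 0 j| <= 1.
    by apply: le_trans xr; have := rV_norm_coord (x - x0) j; rewrite !mxE.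
  have opsq : operator (coeffsP A) t (diagonal (sqdist x0)) x 0 k
      <= 4 * d%:R * L + m%:R * L * d%:R.
    rewrite operator_diagonal -/(rowsumP A k t x).
    have E1 : `|\sum_i \sum_j diffusion A k t x i j * partials [:: i; j] (sqdist x0) x|
        <= d%:R * (L * 2).
      have := @sum_norm_le _ (fun i => \sum_j diffusion A k t x i j
         * partials [:: i; j] (sqdist x0) x) (L * 2).
      rewrite card_ord; apply=> i.
      rewrite (bigD1 i) //= big1 ?addr0 => [|j ji]; rewrite (partials_sqdist2 x0 i _).1.
        by rewrite eqxx mulr1 normrM ler_pM // ger0_norm.
      by rewrite eq_sym (negbTE ji) !mulr0.
    have E2 : `|\sum_j drift A k t x 0 j * partials [:: j] (sqdist x0) x| <= d%:R * (L * 2).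
      have := @sum_norm_le _ (fun j => drift A k t x 0 j
         * partials [:: j] (sqdist x0) x) (L * 2).
      rewrite card_ord; apply=> j.
      rewrite (partials_sqdist1 x0 j).1 normrM ler_pM // normrM ger0_norm //.
      by rewrite ler_piMr.
    have E3 : rowsumP A k t x * sqdist x0 x <= m%:R * L * d%:R.
      apply: le_trans (ler_norm _) _; rewrite normrM ler_pM //.
      by rewrite ger0_norm // sqdist_ge0.
    have := le_trans (ler_norm _) E1; have := le_trans (ler_norm _) E2; move: E3 => /=.
    by lra.
  rewrite operator_diagonal_cst.
  have ratetau : rate * tau <= 1.
    by apply: le_trans rate_tau1; rewrite ler_wpM2l // (le_trans _ rate1).
  have al0 : 0 <= al tau.
    rewrite /al addr_ge0 //; first by rewrite mulr_ge0 // ltW.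
    by rewrite mulr_ge0 // ?(le_trans _ rate1) // ltW.
  have al1 : al tau <= 2 * eps + 1 by rewrite /al lerD2l.
  have mL0 : 0 <= m%:R * L by rewrite mulr_ge0.
  have h1 : al tau * rowsumP A k t x <= (2 * eps + 1) * (m%:R * L).
    apply: le_trans (_ : al tau * (m%:R * L) <= _); last by rewrite ler_wpM2r.
    by rewrite ler_wpM2l // (le_trans (ler_norm _)).
  have h2 : K * operator (coeffsP A) t (diagonal (sqdist x0)) x 0 k
     <= K * (4 * d%:R * L + m%:R * L * d%:R) by rewrite ler_wpM2l.
  rewrite {1}/rate /small_time_rate; move: gM h1 h2; lra.
- move=> tau x k /andP[tau0 taut] xr bnd; rewrite vE zE /al.
  have sq0 := sqdist_ge0 x0 x.
  have rt : 0 <= rate * tau by rewrite mulr_ge0 // (le_trans _ rate1).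
  case: bnd => [t0|x1].
    rewrite t0 (solution_init hu) mulr0 addr0; have := fosc x k xr; lra.
  have : `|u tau x 0 k - f x0 0 k| <= 2 * M.
    apply: le_trans (ler_normB _ _) _.
    have tau01 : 0 <= tau <= 1 by rewrite tau0 (le_trans taut).
    by have := uM tau x k tau01; have := fM k; lra.
  have : 1 <= sqdist x0 x.
    by have := sqdist_ge (ler01) (_ : 1 <= `|x - x0|); rewrite expr1n; apply; rewrite x1.
  move=> sq1; have : K * 1 <= K * sqdist x0 x by rewrite ler_wpM2l.
  by lra.
- by rewrite lexx andbT; case/andP: tau1_01.
Qed.

End small_time.

(** * Uniformity over bounded sets of frozen times *)

Section uniformity_in_frozen_time.
Variables (R : realType) (d m : nat).
Implicit Types (A : coeffs R d m) (I J : set R).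

Lemma right_halfline_interval I : right_halfline I -> is_interval I.
Proof.
move=> [->//|[a [|] ->]]; exact: interval_is_interval.
Qed.

Lemma right_halfline_bounded I (N : R) : right_halfline I ->
  bounded_subinterval I (I `&` [set t | `|t| <= N]).
Proof.
move=> hI; split; last by move=> t [].
  move=> a b [Ia Na] [Ib Nb] c acb; split.
    exact: (right_halfline_interval hI Ia Ib acb).
  by move: Na Nb acb; rewrite /= !ler_norml; lra.
exists N; split; first exact: num_real.
by move=> M NM t [_ /= tN]; apply: le_trans (ltW NM).
Qed.

(** I may be open at its left end, so the radius depends on t0. *)
Lemma right_halfline_nbhs I t0 : right_halfline I -> I t0 ->
  exists2 e : R, 0 < e & let J := I `&` [set t | `|t - t0| <= e] in
    bounded_subinterval I J /\ compact J.
Proof.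
move=> hI It0.
have [e e0 [a [b E]]] : exists2 e : R, 0 < e &
    exists a b, I `&` [set t | `|t - t0| <= e] = `[a, b]%classic.
  case: hI => [->|[a [|] EI]].
  - exists 1 => //; exists (t0 - 1), (t0 + 1); rewrite setTI.
    by apply/seteqP; split=> t /=; rewrite in_itv /= ler_norml; lra.
  - move: It0; rewrite EI /= in_itv /= andbT => at0.
    exists ((t0 - a) / 2); first lra.
    exists (t0 - (t0 - a) / 2), (t0 + (t0 - a) / 2).
    apply/seteqP; split=> t /=; rewrite !in_itv /= ler_norml ?andbT; first by move=> []; lra.
    by move=> h; split; lra.
  - exists 1 => //; exists (Num.max a (t0 - 1)), (t0 + 1); rewrite EI.
    apply/seteqP; split=> t /=; rewrite !in_itv /= ler_norml ?andbT ge_max.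
      by move=> [h1 /andP[h2 h3]]; apply/andP; split; [apply/andP; split; lra|lra].
    by move=> /andP[/andP[h1 h2] h3]; split; [|apply/andP; split; lra].
exists e => //=; split; last by rewrite E; exact: segment_compact.
split; last by move=> t [].
  by rewrite E; exact: interval_is_interval.
by rewrite E; apply: compact_bounded; exact: segment_compact.
Qed.

Lemma enorm_sqr (x : 'rV[R]_d) : dotv x x = \sum_j x 0 j ^+ 2.
Proof. by rewrite /dotv mxE; apply: eq_bigr => j _; rewrite mxE expr2. Qed.

Lemma norm_le_enorm (x : 'rV[R]_d) : `|x| <= enorm x.
Proof.
apply/rV_norm_leP => [|j]; first exact: sqrtr_ge0.
rewrite /enorm enorm_sqr -sqrtr_sqr ler_sqrt; last first.
  by apply: sumr_ge0 => i _; exact: sqr_ge0.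
by rewrite (bigD1 j) //= lerDl sumr_ge0 // => i _; exact: sqr_ge0.
Qed.

Lemma enorm_le_norm (x : 'rV[R]_d) : enorm x <= d.+1%:R * `|x|.
Proof.
rewrite /enorm enorm_sqr.
have N0 : 0 <= d.+1%:R * `|x| by rewrite mulr_ge0.
rewrite -[leRHS]ger0_norm // -sqrtr_sqr ler_sqrt ?sqr_ge0 //.
have le1 : \sum_j x 0 j ^+ 2 <= \sum_(j < d) `|x| ^+ 2.
  apply: ler_sum => j _; rewrite -real_normK ?num_real // ler_pXn2r ?nnegrE //.
  exact: rV_norm_coord.
apply: le_trans le1 _; rewrite sumr_const card_ord -[leLHS]mulr_natl exprMn ler_wpM2r ?sqr_ge0 //.
by rewrite -natrX ler_nat expnS expn1 -[leqLHS]muln1 leq_mul // ltnW.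
Qed.

Lemma lyapunov_uniform I A J : cond_iii I A -> bounded_subinterval I J ->
  exists phi lam, forall t, J t -> lyapunov A t phi lam.
Proof.
move=> Aiii bJ; have [phi [lam [phi2 phi0 phiinf lam0 sup]]] := Aiii J bJ.
exists phi, lam => t Jt; split=> //; first by move=> x k; exact: sup.
move=> M.
have [r r0 hr] := @finite_upper R 'I_m
    (fun k r => forall x, r < enorm x -> M < phi x 0 k)
    (fun k r r' h rr' x r'x => h x (le_lt_trans rr' r'x)) (fun k => phiinf k M).
exists (r + 1); first by rewrite addr_ge0.
move=> x k rx; apply: hr; apply: lt_le_trans (norm_le_enorm x).
by apply: lt_le_trans rx; rewrite ltrDl.
Qed.

Lemma rowsum_uniform I A J : cond_v I A -> bounded_subinterval I J ->
  exists2 kappa, 0 <= kappa & forall t x k, J t -> rowsumP A k t x <= kappa.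
Proof.
move=> Av bJ.
have [kappa k0 h] := @finite_upper R 'I_m
    (fun k c => forall t x, J t -> rowsumP A k t x <= c)
    (fun k r r' h rr' t x Jt => le_trans (h t x Jt) rr') (fun k => Av J k bJ).
by exists kappa => // t x k; exact: h.
Qed.

(** One constant for all the diffusion, drift and coupling coefficients. *)
Lemma finite_bound3 (P : 'I_m -> 'I_d -> 'I_d -> R -> Prop) (Q : 'I_m -> 'I_d -> R -> Prop)
    (S : 'I_m -> 'I_m -> R -> Prop) :
  (forall k i j r r', P k i j r -> r <= r' -> P k i j r') ->
  (forall k j r r', Q k j r -> r <= r' -> Q k j r') ->
  (forall k h r r', S k h r -> r <= r' -> S k h r') ->
  (forall k i j, exists r, P k i j r) -> (forall k j, exists r, Q k j r) ->
  (forall k h, exists r, S k h r) ->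
  exists2 r, 0 <= r & [/\ forall k i j, P k i j r, forall k j, Q k j r & forall k h, S k h r].
Proof.
move=> Pm Qm Sm Pe Qe Se.
have [r1 r10 h1] := @finite_upper R ('I_m * 'I_d * 'I_d)%type
  (fun q => P q.1.1 q.1.2 q.2) (fun q => Pm _ _ _) (fun q => Pe _ _ _).
have [r2 r20 h2] := @finite_upper R ('I_m * 'I_d)%type
  (fun q => Q q.1 q.2) (fun q => Qm _ _) (fun q => Qe _ _).
have [r3 r30 h3] := @finite_upper R ('I_m * 'I_m)%type
  (fun q => S q.1 q.2) (fun q => Sm _ _) (fun q => Se _ _).
exists (r1 + r2 + r3); first by rewrite !addr_ge0.
split=> [k i j|k j|k h].
- by apply: Pm (h1 (k, i, j)) _; lra.
- by apply: Qm (h2 (k, j)) _; lra.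
- by apply: Sm (h3 (k, h)) _; lra.
Qed.

Lemma holder_loc_cylinder alpha I J (g : R -> 'rV[R]_d -> R) (r : R) :
  0 < alpha -> holder_loc alpha I g -> compact J -> J `<=` I ->
  exists M : R, forall t t' x y, J t -> J t' -> `|x| <= r -> `|y| <= r ->
    `|g t x - g t' y| <= M * (`|t - t'| `^ (alpha / 2) + enorm (x - y) `^ alpha).
Proof.
move=> alpha0 hg cJ JI.
have cK : compact (J `*` [set x : 'rV[R]_d | `|x - 0| <= r]).
  by apply: compact_setX => //; exact: compact_ball.
have [|M hM] := hg _ cK; first by move=> p [Jp _]; split=> //; exact: JI.
exists M => t t' x y Jt Jt' xr yr.
by apply: (hM (t, x) (t', y)); split; rewrite /= ?subr0.
Qed.

Lemma holder_loc_bounded alpha I J (g : R -> 'rV[R]_d -> R) (r : R) :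
  0 < alpha -> holder_loc alpha I g -> compact J -> J `<=` I ->
  exists L : R, forall t x, J t -> `|x| <= r -> `|g t x| <= L.
Proof.
move=> alpha0 hg cJ JI.
have [[t0 Jt0]|Jempty] := pselect (exists t, J t); last first.
  by exists 0 => t x Jt; exfalso; apply: Jempty; exists t.
have [M hM] := holder_loc_cylinder r alpha0 hg cJ JI.
have [N [_ hN]] := compact_bounded cJ.
have JN t : J t -> `|t| <= N + 1 by move=> Jt; apply: (hN (N + 1)) => //; rewrite ltrDl.
have [r0|r_lt0] := leP 0 r; last first.
  by exists 0 => t x _ xr; have := le_lt_trans xr r_lt0; rewrite ltNge normr_ge0.
exists (`|g t0 0| + `|M| * ((N + 1 + (N + 1)) `^ (alpha / 2) + (d.+1%:R * r) `^ alpha)).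
move=> t x Jt xr.
have := hM t t0 x 0 Jt Jt0 xr; rewrite normr0 subr0 => /(_ r0) h.
rewrite -[g t x](subrK (g t0 0)) addrC; apply: le_trans (ler_normD _ _) _.
rewrite lerD2l; apply: le_trans h _.
apply: le_trans (ler_wpM2r _ (ler_norm M)) _; first by rewrite addr_ge0 // powR_ge0.
rewrite ler_wpM2l // lerD //.
  apply: ge0_ler_powR; rewrite ?nnegrE //; first by rewrite divr_ge0 // ltW.
    by rewrite addr_ge0 // (le_trans _ (JN t Jt)).
  by apply: le_trans (ler_normB _ _) _; rewrite lerD // JN.
apply: ge0_ler_powR; rewrite ?nnegrE ?sqrtr_ge0 //; first by rewrite ltW.
  by rewrite mulr_ge0.
by apply: le_trans (enorm_le_norm _) _; rewrite ler_wpM2l.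
Qed.

Lemma coeffs_bounded_uniform alpha I A J (r : R) :
  0 < alpha -> cond_i alpha I A -> compact J -> J `<=` I ->
  exists2 L : R, 0 <= L & forall t, J t -> coeffs_bounded_on A t [set x | `|x| <= r] L.
Proof.
move=> alpha0 [_ [hq hb hc]] cJ JI.
have B (g : R -> 'rV[R]_d -> R) : Cn_holder_loc 0 alpha I g ->
    exists L : R, forall t x, J t -> `|x| <= r -> `|g t x| <= L.
  move=> [_ /(_ [::] isT) hg].
  exact: (holder_loc_bounded r alpha0 hg cJ JI).
have mono (g : R -> 'rV[R]_d -> R) : forall L L' : R,
    (forall t (x : 'rV[R]_d), J t -> `|x| <= r -> `|g t x : R| <= L) -> L <= L' ->
    forall t x, J t -> `|x| <= r -> `|g t x| <= L'.
  by move=> L L' h LL' t x Jt xr; apply: le_trans LL'; exact: h.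
have [L L0 [h1 h2 h3]] := finite_bound3 (fun k i j => mono _) (fun k j => mono _)
  (fun k h => mono _) (fun k i j => B _ (hq k i j)) (fun k j => B _ (hb k j))
  (fun k h => B _ (hc k h)).
exists L => // t Jt x k /= xr; split=> [i j|j|h].
- exact: h1.
- exact: h2.
- exact: h3.
Qed.

Definition coeffs_close A (t t0 : R) (C : set 'rV[R]_d) (e : R) : Prop :=
  forall x k, C x -> [/\
    forall i j, `|diffusion A k t x i j - diffusion A k t0 x i j| <= e,
    forall j, `|drift A k t x 0 j - drift A k t0 x 0 j| <= e &
    forall h, `|coupling A t x k h - coupling A t0 x k h| <= e].

Lemma coeffs_close_near alpha I A J t0 (r e : R) :
  0 < alpha -> cond_i alpha I A -> compact J -> J `<=` I -> J t0 -> 0 < e ->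
  exists2 eta : R, 0 < eta & forall t, J t -> `|t - t0| < eta ->
    coeffs_close A t t0 [set x | `|x| <= r] e.
Proof.
move=> alpha0 [_ [hq hb hc]] cJ JI Jt0 e0.
pose close (g : R -> 'rV[R]_d -> R) M := forall t x, J t -> `|x| <= r ->
  `|g t x - g t0 x| <= M * `|t - t0| `^ (alpha / 2).
have B (g : R -> 'rV[R]_d -> R) : Cn_holder_loc 0 alpha I g -> exists M : R, close g M.
  move=> [_ /(_ [::] isT) hg].
  have [M hM] := holder_loc_cylinder r alpha0 hg cJ JI.
  exists M => t x Jt xr; have := hM t t0 x x Jt Jt0 xr xr.
  rewrite subrr [enorm 0](_ : _ = 0) ?powR0 ?addr0 //; first by rewrite gt_eqF.
  by apply/eqP; rewrite eq_le sqrtr_ge0 andbT (le_trans (enorm_le_norm _)) // normr0 mulr0.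
have mono (g : R -> 'rV[R]_d -> R) L L' : close g L -> L <= L' -> close g L'.
  by move=> h LL' t x Jt xr; apply: le_trans (h t x Jt xr) _; rewrite ler_wpM2r ?powR_ge0.
have [L L0 [h1 h2 h3]] := finite_bound3 (fun k i j => mono _) (fun k j => mono _)
  (fun k h => mono _) (fun k i j => B _ (hq k i j)) (fun k j => B _ (hb k j))
  (fun k h => B _ (hc k h)).
have L1 : 0 < L + 1 by rewrite ltr_wpDl.
have a2 : 0 < alpha / 2 by rewrite divr_gt0.
(* The inverse at e of the modulus (L + 1) |t - t0|^(alpha / 2). *)
exists ((e / (L + 1)) `^ (alpha / 2)^-1); first by rewrite powR_gt0 // divr_gt0.
move=> t Jt tt0 x k /= xr.
have small : L * `|t - t0| `^ (alpha / 2) <= e.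
  apply: le_trans (_ : (L + 1) * (e / (L + 1)) <= _); last by rewrite mulrC divfK // gt_eqF.
  apply: ler_pM; rewrite ?powR_ge0 //; first by rewrite lerDl.
  have := ge0_ler_powR (ltW a2) (_ : _ \in Num.nneg) (_ : _ \in Num.nneg) (ltW tt0).
  rewrite -powRrM mulVf ?gt_eqF // powRr1; last by rewrite divr_ge0 // ltW.
  by apply; rewrite nnegrE // powR_ge0.
by split=> *; apply: le_trans small; [apply: h1|apply: h2|apply: h3].
Qed.

Lemma Cb_bound (f : 'rV[R]_d -> 'rV[R]_m) : Cb f ->
  exists2 F, 0 <= F & forall x k, `|f x 0 k| <= F.
Proof.
move=> [_ [N [_ hN]]]; exists `|N + 1| => // x k.
apply: le_trans (rV_norm_coord _ _) _; apply: le_trans (ler_norm _).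
by apply: hN => //; rewrite ltrDl.
Qed.

End uniformity_in_frozen_time.

(** * Stability estimates *)

Section stability.
Variables (R : realType) (d m : nat).
Implicit Types (A : coeffs R d m) (I J : set R).

Lemma lyapunov_bounds A t phi lam (r : R) : lyapunov A t phi lam -> 0 <= r ->
  exists c P : R, [/\ 0 < c, 0 < P &
    forall x k, `|x| <= r -> c <= phi x 0 k <= P].
Proof.
move=> [phi2 phi0 _ _ _] r0.
have cB : compact [set x : 'rV[R]_d | `|x - 0| <= r] by exact: compact_ball.
have phic k : {within [set x : 'rV[R]_d | `|x - 0| <= r], continuous (fun x => phi x 0 k)}.
  by apply: continuous_subspaceT; case: (phi2 k) => _ /(_ [::] isT).
have B0 : [set x : 'rV[R]_d | `|x - 0| <= r] !=set0.
  by exists 0; rewrite /= subr0 normr0.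
have [N N0 hN] : exists2 N, 0 <= N & forall k x, `|x| <= r ->
    phi x 0 k <= N /\ 1 <= N * phi x 0 k.
  apply: finite_upper => [k N N' h NN' x xr|k].
    have [h1 h2] := h x xr; split; first exact: le_trans NN'.
    by apply: le_trans h2 _; rewrite ler_wpM2r // ltW.
  have [N N0 hN] := compact_norm_bounded cB (phic k).
  have [y _ ymin] := compact_EVT_min B0 cB (phic k).
  exists (N + (phi y 0 k)^-1) => x xr; have xB : `|x - 0| <= r by rewrite subr0.
  have y0 : 0 < (phi y 0 k)^-1 by rewrite invr_gt0.
  split; first by apply: le_trans (ler_norm _) _; apply: le_trans (hN x xB) _; rewrite lerDl ltW.
  have h : phi y 0 k <= phi x 0 k by apply: ymin; rewrite inE.
  rewrite mulrDl; apply: le_trans (_ : (phi y 0 k)^-1 * phi x 0 k <= _).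
    by rewrite -[leLHS](@mulVf _ (phi y 0 k)) ?gt_eqF // ler_pM2l.
  by rewrite lerDr mulr_ge0 // ltW.
have N1 : 0 < N + 1 by rewrite ltr_wpDl.
exists (N + 1)^-1, (N + 1); split; rewrite ?invr_gt0 // => x k xr.
have [h1 h2] := hN k x xr; apply/andP; split; last by apply: le_trans h1 _; rewrite lerDl.
rewrite -(ler_pM2l N1) mulfV ?gt_eqF //; apply: le_trans h2 _.
by rewrite ler_wpM2r ?ltW // ltrDl.
Qed.

(** Choose a with a e^((lam + 1) tau1) phi <= eps on the ball of radius r, then rho
    so large that a phi exceeds N on the sphere of radius rho; half a
    positive lower bound of a phi on that ball is an admissible del. *)
Lemma barrier_stability I A J (tau1 r N eps : R) :
  cond_iii I A -> bounded_subinterval I J -> 0 <= r -> 0 <= tau1 -> 0 <= N -> 0 < eps ->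
  exists rho del : R, [/\ r <= rho, 0 < del &
  forall t t0 v g, J t -> elliptic A t -> 0 <= t0 <= tau1 -> regular t0 v ->
    (forall k, {within cylinder t0 tau1 0 rho, continuous (fun p => v p.1 p.2 0 k)}) ->
    (forall tau (x : 'rV[R]_d) k, t0 < tau <= tau1 -> `|x| <= rho ->
       dtime v tau x k = operator A t (v tau) x 0 k + g tau x k /\ `|g tau x k| <= del) ->
    (forall (x : 'rV[R]_d) k, `|x| <= rho -> `|v t0 x 0 k| <= del) ->
    (forall tau (x : 'rV[R]_d) k, t0 <= tau <= tau1 -> `|v tau x 0 k| <= N) ->
    forall tau (x : 'rV[R]_d) k, t0 <= tau <= tau1 -> `|x| <= r -> `|v tau x 0 k| <= eps].
Proof.
move=> Aiii bJ r0 tau10 N0 eps0.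
have [phi [lam lyap]] := lyapunov_uniform Aiii bJ.
have [[t' Jt']|Jempty] := pselect (exists t, J t); last first.
  by exists r, 1; split=> // t t0 v g Jt; exfalso; apply: Jempty; exists t.
have lyap' := lyap _ Jt'.
have [c1 [P [_ P0 hP]]] := lyapunov_bounds lyap' r0.
have [_ _ lam0 _ phiinf] := lyap'.
pose E := expR ((lam + 1) * tau1).
have E0 : 0 < E by exact: expR_gt0.
pose a := eps / (E * P).
have a0 : 0 < a by rewrite divr_gt0 // mulr_gt0.
have [r1 r10 hr1] := phiinf (N / a).
pose rho := Num.max r r1.
have rho0 : 0 <= rho by rewrite le_max r0.
have [c [P' [c0 _ hc]]] := lyapunov_bounds lyap' rho0.
have ac0 : 0 < a * c by rewrite mulr_gt0.
exists rho, (a * c / 2); split; [by rewrite le_max lexx|by rewrite divr_gt0|].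
move=> t t0 v g Jt ell /andP[t00 t01] regv cv eqv vinit vN tau x k taut xr.
have half : a * c / 2 < a * c by lra.
have aphi y l : `|y| <= rho -> a * c / 2 < a * phi y 0 l.
  by move=> yr; apply: lt_le_trans half _; rewrite ler_pM2l //; case/andP: (hc y l yr).
have main : `|v tau x 0 k| < a * expR ((lam + 1) * (tau - t0)) * phi x 0 k.
  apply: (lyapunov_barrier (g := g) (t1 := tau1) (rho := rho) ell (lyap t Jt)) => //.
  - by move=> s y l sT yr; case: (eqv s y l sT (ltW yr)).
  - move=> s y l sT yr; have [_ gs] := eqv s y l sT (ltW yr).
    by apply: le_lt_trans gs _; apply: aphi; exact: ltW.
  - by move=> y l yr; apply: le_lt_trans (vinit y l yr) _; exact: aphi.
  - move=> s y l sT yr; apply: le_lt_trans (vN s y l sT) _.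
    have := hr1 y l; rewrite yr le_max lexx orbT => /(_ isT).
    by rewrite ltr_pdivrMr // mulrC.
  - by rewrite (le_trans xr) // le_max lexx.
apply: le_trans (ltW main) _.
have -> : eps = a * E * P by rewrite /a -mulrA divfK // gt_eqF // mulr_gt0.
have lam1 : 0 <= lam + 1 by rewrite addr_ge0 // ltW.
have [t0tau tautau1] := andP taut.
apply: ler_pM.
- by rewrite mulr_ge0 ?expR_ge0 // ltW.
- by case: (lyap t Jt) => _ /(_ x k)/ltW.
- by rewrite ler_pM2l // ler_expR ler_wpM2l // lerBlDr (le_trans tautau1) // lerDl.
- by case/andP: (hP x k xr).
Qed.

Lemma difference_regular A t t' f f' u u' :
  bounded_classical_solution A t f u -> bounded_classical_solution A t' f' u' ->
  regular 0 (fun tau x => 1 *: u tau x + (-1) *: u' tau x).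
Proof.
by move=> hu hu'; apply: regular_lin; [exact: solution_regular hu|exact: solution_regular hu'].
Qed.

Lemma differenceE (u u' : R -> 'rV[R]_d -> 'rV[R]_m) tau x k :
  (1 *: u tau x + (-1) *: u' tau x) 0 k = u tau x 0 k - u' tau x 0 k.
Proof. by rewrite !mxE mul1r mulN1r. Qed.

Lemma difference_continuous A t t' f f' u u' (D : set (R * 'rV[R]_d)) k :
  bounded_classical_solution A t f u -> bounded_classical_solution A t' f' u' ->
  (forall p, D p -> 0 <= p.1) ->
  {within D, continuous (fun p => (1 *: u p.1 p.2 + (-1) *: u' p.1 p.2) 0 k)}.
Proof.
move=> hu hu' D0; under eq_fun do rewrite differenceE.
move=> p; apply: cvgB.
  exact: (@solution_continuous _ _ _ _ _ _ _ hu _ k D0).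
exact: (@solution_continuous _ _ _ _ _ _ _ hu' _ k D0).
Qed.

(** The discrepancy falls on u' alone: if u' is a fixed solution, the bounds on its
    derivatives serve for every u. *)
Lemma difference_dtime A t t' f f' u u' tau x k :
  bounded_classical_solution A t f u -> bounded_classical_solution A t' f' u' ->
  0 < tau ->
  dtime (fun tau x => 1 *: u tau x + (-1) *: u' tau x) tau x k
  = operator A t (fun y => 1 *: u tau y + (-1) *: u' tau y) x 0 k
    + (operator A t (u' tau) x 0 k - operator A t' (u' tau) x 0 k).
Proof.
move=> hu hu' tau0.
rewrite (dtime_lin _ _ _ _ (solution_regular hu) (solution_regular hu') tau0).
rewrite operator_lin; [|exact: (solution_smooth2 hu tau0)|exact: (solution_smooth2 hu' tau0)].
by rewrite (solution_dtime hu) // (solution_dtime hu') //; ring.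
Qed.

Lemma operator_discrepancy A t t0 (C : set 'rV[R]_d) (e N : R) (zeta : 'rV[R]_d -> 'rV[R]_m) x k :
  coeffs_close A t t0 C e -> C x -> 0 <= e ->
  (forall i j, `|partials [:: i; j] (fun y => zeta y 0 k) x| <= N) ->
  (forall j, `|partials [:: j] (fun y => zeta y 0 k) x| <= N) ->
  (forall h, `|zeta x 0 h| <= N) ->
  `|operator A t zeta x 0 k - operator A t0 zeta x 0 k|
    <= (d%:R * d%:R + d%:R + m%:R) * (e * N).
Proof.
move=> close Cx e0 N2 N1 N0; have [q b c] := close x k Cx.
rewrite !operatorE.
have split3 (a1 a2 a3 b1 b2 b3 : R) :
    a1 + a2 + a3 - (b1 + b2 + b3) = (a1 - b1) + (a2 - b2) + (a3 - b3) by ring.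
rewrite split3.
rewrite !mulrDl; apply: le_trans (ler_normD _ _) _; apply: lerD.
  apply: le_trans (ler_normD _ _) _; apply: lerD.
    rewrite -sumrB -mulrA.
    have := @sum_norm_le R _ (fun i : 'I_d => \sum_j diffusion A k t x i j
        * partials [:: i; j] (fun y => zeta y 0 k) x - \sum_j diffusion A k t0 x i j
        * partials [:: i; j] (fun y => zeta y 0 k) x) (d%:R * (e * N)).
    rewrite card_ord; apply=> i; rewrite -sumrB.
    have := @sum_norm_le R _ (fun j : 'I_d => diffusion A k t x i j
        * partials [:: i; j] (fun y => zeta y 0 k) x - diffusion A k t0 x i j
        * partials [:: i; j] (fun y => zeta y 0 k) x) (e * N).
    by rewrite card_ord; apply=> j; rewrite -mulrBl normrM ler_pM.
  rewrite -sumrB.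
  have := @sum_norm_le R _ (fun j : 'I_d => drift A k t x 0 j
      * partials [:: j] (fun y => zeta y 0 k) x - drift A k t0 x 0 j
      * partials [:: j] (fun y => zeta y 0 k) x) (e * N).
  by rewrite card_ord; apply=> j; rewrite -mulrBl normrM ler_pM.
rewrite -sumrB.
have := @sum_norm_le R _ (fun h : 'I_m => coupling A t x k h * zeta x 0 h
    - coupling A t0 x k h * zeta x 0 h) (e * N).
by rewrite card_ord; apply=> h; rewrite -mulrBl normrM ler_pM.
Qed.

(** The oscillation hypothesis of solution_small_time holds with one K for all x0 in
    the ball: uniform continuity handles points within rho of x0, and
    K |x - x0|^2 >= 2 F the others. *)
Lemma small_time_uniform alpha I A J f (r eps : R) :
  0 < alpha -> cond_i alpha I A -> cond_ii I A -> cond_iii I A -> cond_v I A ->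
  bounded_subinterval I J -> compact J -> Cb f -> 0 < eps ->
  exists2 del : R, 0 < del & forall t u, J t -> bounded_classical_solution A t f u ->
    forall tau (x : 'rV[R]_d) k, 0 <= tau <= del -> `|x| <= r ->
      `|u tau x 0 k - f x 0 k| <= eps.
Proof.
move=> alpha0 Ai Aii Aiii Av bJ cJ Cf eps0.
have JI : J `<=` I by case: bJ.
have [F F0 fF] := Cb_bound Cf; have [fc _] := Cf.
have [phi [lam lyap]] := lyapunov_uniform Aiii bJ.
have [kappa kappa0 row] := rowsum_uniform Av bJ.
have [L L0 coefL] := coeffs_bounded_uniform (r + 1) alpha0 Ai cJ JI.
pose M := F * expR kappa.
have M0 : 0 <= M by rewrite mulr_ge0 // expR_ge0.
have e3 : 0 < eps / 3 by rewrite divr_gt0.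
have clB : closed [set x : 'rV[R]_d | `|x - 0| <= r + 1].
  apply: compact_closed; [exact: norm_hausdorff|exact: compact_ball].
have [rho rho0 osc] := compact_unif_cont (@compact_ball _ _ 0 (r + 1)) clB fc e3.
have rho2 : 0 < rho ^+ 2 by rewrite exprn_gt0.
pose K := 2 * F / rho ^+ 2 + 2 * M.
have KF0 : 0 <= 2 * F / rho ^+ 2 by rewrite divr_ge0 ?(ltW rho2) // mulr_ge0.
have K0 : 0 <= K by rewrite addr_ge0 // mulr_ge0.
pose rate := small_time_rate d m L M K (eps / 3).
have rate1 : 1 <= rate by exact: small_time_rate_ge1.
have rate0 : 0 < rate by exact: lt_le_trans rate1.
exists (Num.min 1 (eps / 3) / rate); first by rewrite divr_gt0 // lt_min ltr01.
move=> t u Jt hu tau x0 k /andP[tau0 tau_le] x0r.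
have ell := elliptic_of_cond Ai Aii (JI t Jt).
have ratetau : rate * tau <= Num.min 1 (eps / 3) by rewrite mulrC -ler_pdivlMr.
have tau_rate : tau <= rate * tau by rewrite ler_peMl.
have ratetau1 : rate * tau <= 1 by apply: le_trans ratetau _; rewrite ge_min lexx.
have ratetau2 : rate * tau <= eps / 3 by apply: le_trans ratetau _; rewrite ge_min lexx orbT.
have in_ball (x : 'rV[R]_d) : `|x - x0| <= 1 -> `|x| <= r + 1.
  move=> xx0; rewrite -(subrK x0 x) addrC; apply: le_trans (ler_normD _ _) _.
  exact: lerD.
have := @solution_small_time R d m A t f u x0 L M K (eps / 3) ell hu e3 K0 L0 M0.
rewrite -/rate => H.
have := H _ _ _ _ tau k; rewrite tau0 (le_trans tau_rate) // ratetau1.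
move=> H'; apply: le_trans (H' _ _ _ _ isT isT) _; last by lra.
- by move=> x l /= xx0; apply: coefL => //=; exact: in_ball.
- move=> s x l /andP[s0 s1].
  apply: le_trans (solution_sup_bound ell (lyap t Jt) (fun x k => row t x k Jt) hu F0 fF x l s0) _.
  by rewrite ler_wpM2l // ler_expR ler_piMr.
- by rewrite /K lerDr.
- move=> x l xx0.
  have [near|far] := ltP `|x - x0| rho.
    apply: le_trans (_ : eps / 3 <= _); last by rewrite lerDl mulr_ge0 // sqdist_ge0.
    have -> : f x 0 l - f x0 0 l = (f x - f x0) 0 l by rewrite !mxE.
    apply: le_trans (rV_norm_coord _ _) _; apply: ltW; apply: osc => //=; rewrite subr0.
      exact: in_ball.
    by rewrite (le_trans x0r) // lerDl.
  apply: le_trans (_ : 2 * F <= _).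
    apply: le_trans (ler_normB _ _) _; have := fF x l; have := fF x0 l; lra.
  have sq := sqdist_ge (ltW rho0) far.
  have : 2 * F / rho ^+ 2 * rho ^+ 2 <= K * sqdist x0 x.
    by apply: ler_pM => //; rewrite ?(ltW rho2) // /K lerDl mulr_ge0.
  by rewrite divfK ?gt_eqF //; lra.
Qed.

End stability.

(** * Dependence on the frozen time and on the datum *)

Section frozen_time.
Variables (R : realType) (d m : nat) (alpha : R) (I : set R) (A : coeffs R d m).
Hypotheses (hI : right_halfline I) (alpha0 : 0 < alpha).
Hypotheses (Ai : cond_i alpha I A) (Aii : cond_ii I A) (Aiii : cond_iii I A).
Hypothesis (Av : cond_v I A).

Lemma solutions_bounded_uniform J (F tau1 : R) : bounded_subinterval I J -> 0 <= F ->
  exists2 M, 0 <= M & forall t f u, J t -> bounded_classical_solution A t f u ->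
    (forall x k, `|f x 0 k| <= F) ->
    forall tau x k, 0 <= tau <= tau1 -> `|u tau x 0 k| <= M.
Proof.
move=> bJ F0; have [phi [lam lyap]] := lyapunov_uniform Aiii bJ.
have [kappa kappa0 row] := rowsum_uniform Av bJ.
exists (F * expR (kappa * tau1)); first by rewrite mulr_ge0 ?expR_ge0.
move=> t f u Jt hu fF tau x k /andP[tau0 tau_le].
have JI : J `<=` I by case: bJ.
have ell := elliptic_of_cond Ai Aii (JI t Jt).
apply: le_trans (solution_sup_bound ell (lyap t Jt) (fun x k => row t x k Jt) hu F0 fF x k tau0) _.
by rewrite ler_wpM2l // ler_expR ler_wpM2l.
Qed.

(** Up to time sig both solutions are close to f; on [sig, tau1] the source
    (A(t) - A(t0)) u0 is small on the ball of radius rho, because the coefficients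
    are close and u0 has bounded derivatives there, so barrier_stability applies
    from time sig on. *)
Lemma frozen_time_continuity f t0 u0 (tau1 r eps : R) :
  I t0 -> Cb f -> bounded_classical_solution A t0 f u0 -> 0 <= tau1 -> 0 <= r -> 0 < eps ->
  exists2 eta : R, 0 < eta & forall t u, I t -> `|t - t0| < eta ->
    bounded_classical_solution A t f u ->
    forall tau (x : 'rV[R]_d) k, 0 <= tau <= tau1 -> `|x| <= r ->
      `|u tau x 0 k - u0 tau x 0 k| <= eps.
Proof.
move=> It0 Cf hu0 tau10 r0 eps0.
have [e e0 /= [bJ cJ]] := right_halfline_nbhs hI It0.
set J := I `&` _ in bJ cJ.
have JI : J `<=` I by case: bJ.
have Jt0 : J t0 by split=> //=; rewrite subrr normr0 ltW.
have [F F0 fF] := Cb_bound Cf.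
have [M M0 uM] := solutions_bounded_uniform tau1 bJ F0.
have M20 : 0 <= 2 * M by rewrite mulr_ge0.
have [rho [del [r_rho del0 barrier]]] := barrier_stability Aiii bJ r0 tau10 M20 eps0.
have me0 : 0 < Num.min del eps by rewrite lt_min del0.
have me1 : Num.min del eps <= del by rewrite ge_min lexx.
have me2 : Num.min del eps <= eps by rewrite ge_min lexx orbT.
have half0 : 0 < Num.min del eps / 2 by rewrite divr_gt0.
have [sig sig0 small] := small_time_uniform rho alpha0 Ai Aii Aiii Av bJ cJ Cf half0.
have cyl_pos (p : R * 'rV[R]_d) : cylinder sig tau1 0 rho p -> 0 < p.1.
  by move=> [/andP[h _] _]; exact: lt_le_trans h.
have Nex k s : (size s <= 2)%N -> exists N : R, forall p, cylinder sig tau1 0 rho p ->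
    `|partials s (fun y => u0 p.1 y 0 k) p.2| <= N.
  move=> ss; have [N _ hN] := compact_norm_bounded (@compact_cylinder R d sig tau1 0 rho)
    (@solution_partials_continuous _ _ _ _ _ _ _ hu0 _ k s cyl_pos ss).
  by exists N.
have [N N0 [N2 N1 Nz]] := finite_bound3
  (P := fun k i j N => forall p, cylinder sig tau1 0 rho p ->
    `|partials [:: i; j] (fun y => u0 p.1 y 0 k) p.2| <= N)
  (Q := fun k j N => forall p, cylinder sig tau1 0 rho p ->
    `|partials [:: j] (fun y => u0 p.1 y 0 k) p.2| <= N)
  (S := fun k h N => forall p, cylinder sig tau1 0 rho p ->
    `|partials [::] (fun y => u0 p.1 y 0 h) p.2| <= N)
  (fun k i j N N' h NN' p cp => le_trans (h p cp) NN')
  (fun k j N N' h NN' p cp => le_trans (h p cp) NN')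
  (fun k l N N' h NN' p cp => le_trans (h p cp) NN')
  (fun k i j => Nex k [:: i; j] isT) (fun k j => Nex k [:: j] isT)
  (fun k h => Nex h [::] isT).
pose D := d%:R * d%:R + d%:R + m%:R : R.
have D0 : 0 <= D by rewrite /D -natrM -!natrD.
have DN1 : 0 < D * N + 1 by rewrite ltr_wpDl // mulr_ge0.
have e'0 : 0 < del / (D * N + 1) by rewrite divr_gt0.
have [eta eta0 close] := coeffs_close_near rho alpha0 Ai cJ JI Jt0 e'0.
exists (Num.min e eta); first by rewrite lt_min e0.
move=> t u It; rewrite lt_min => /andP[te teta] hu tau x k /andP[tau0 tau_le] xr.
have Jt : J t by split=> //=; exact: ltW.
have init s (y : 'rV[R]_d) l : 0 <= s <= sig -> `|y| <= rho ->
    `|u s y 0 l - u0 s y 0 l| <= Num.min del eps.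
  move=> ssig yr; have h1 := small t u Jt hu s y l ssig yr.
  have h2 := small t0 u0 Jt0 hu0 s y l ssig yr.
  rewrite -[u s y 0 l](subrK (f y 0 l)) -addrA; apply: le_trans (ler_normD _ _) _.
  by move: h2; rewrite distrC; lra.
have [tau_sig|sig_tau] := leP tau sig.
  apply: le_trans me2; apply: init; first by rewrite tau0.
  exact: le_trans r_rho.
rewrite -differenceE.
apply: (barrier t sig (fun tau x => 1 *: u tau x + (-1) *: u0 tau x)
  (fun tau x k => operator A t (u0 tau) x 0 k - operator A t0 (u0 tau) x 0 k)) => //.
- exact: elliptic_of_cond Ai Aii It.
- by rewrite (ltW sig0) (le_trans (ltW sig_tau)).
- by move=> s sigs; apply: (difference_regular hu hu0); exact: lt_trans sigs.
- move=> l; exact: (@difference_continuous _ _ _ _ _ _ _ _ _ _ _ l hu hu0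
    (fun p cp => ltW (cyl_pos p cp))).
- move=> s y l /andP[sigs stau1] yr; split.
    by rewrite (difference_dtime _ _ hu hu0) // (lt_trans sig0).
  have cyl : cylinder sig tau1 0 rho (s, y) by split; rewrite /= ?subr0 // ltW.
  apply: le_trans (operator_discrepancy (close t Jt teta) yr (ltW e'0)
    (fun i j => N2 l i j _ cyl) (fun j => N1 l j _ cyl) (fun h => Nz l h _ cyl)) _.
  rewrite -/D (_ : D * _ = del * (D * N) / (D * N + 1)); last by ring.
  rewrite ler_pdivrMr //.
  by rewrite ler_pM2l // lerDl.
- move=> y l yr; rewrite differenceE; apply: le_trans me1; apply: init => //.
  by rewrite lexx ltW.
- move=> s y l /andP[sigs stau1]; rewrite differenceE.
  have s01 : 0 <= s <= tau1 by rewrite stau1 andbT; apply: le_trans sigs; exact: ltW.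
  apply: le_trans (ler_normB _ _) _.
  have := uM t f u Jt hu fF s y l s01; have := uM t0 f u0 Jt0 hu0 fF s y l s01; lra.
- by rewrite (ltW sig_tau).
Qed.

Lemma initial_data_stability J (F tau1 r eps : R) : bounded_subinterval I J ->
  0 <= F -> 0 <= tau1 -> 0 <= r -> 0 < eps ->
  exists rho del : R, 0 < del /\ forall t f f' u u', J t ->
    bounded_classical_solution A t f u -> bounded_classical_solution A t f' u' ->
    (forall x k, `|f x 0 k| <= F) -> (forall x k, `|f' x 0 k| <= F) ->
    (forall (x : 'rV[R]_d) k, `|x| <= rho -> `|f x 0 k - f' x 0 k| <= del) ->
    forall tau (x : 'rV[R]_d) k, 0 <= tau <= tau1 -> `|x| <= r ->
      `|u tau x 0 k - u' tau x 0 k| <= eps.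
Proof.
move=> bJ F0 tau10 r0 eps0.
have JI : J `<=` I by case: bJ.
have [M M0 uM] := solutions_bounded_uniform tau1 bJ F0.
have M20 : 0 <= 2 * M by rewrite mulr_ge0.
have [rho [del [r_rho del0 barrier]]] := barrier_stability Aiii bJ r0 tau10 M20 eps0.
exists rho, del; split=> // t f f' u u' Jt hu hu' fF fF' ff' tau x k taut xr.
rewrite -differenceE.
apply: (barrier t 0 (fun tau x => 1 *: u tau x + (-1) *: u' tau x) (fun _ _ _ => 0)) => //.
- exact: elliptic_of_cond Ai Aii (JI t Jt).
- by rewrite lexx.
- exact: difference_regular hu hu'.
- have cyl_pos (p : R * 'rV[R]_d) : cylinder 0 tau1 0 rho p -> 0 <= p.1 by move=> [/andP[]].
  by move=> l; exact: (@difference_continuous _ _ _ _ _ _ _ _ _ _ _ l hu hu' cyl_pos).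
- move=> s y l /andP[s0 _] yr; rewrite normr0 ltW //; split=> //.
  by rewrite (difference_dtime _ _ hu hu') // subrr.
- by move=> y l yr; rewrite differenceE (solution_init hu) (solution_init hu'); exact: ff'.
- move=> s y l s01; rewrite differenceE; apply: le_trans (ler_normB _ _) _.
  have := uM t f u Jt hu fF s y l s01; have := uM t f' u' Jt hu' fF' s y l s01; lra.
Qed.

End frozen_time.

Lemma uniform_cvg_dist (R : realType) (U : choiceType) (m : nat) (K : set U)
    (F : nat -> U -> 'rV[R]_m) (f : U -> 'rV[R]_m) :
  {uniform K, F @ \oo --> f} <->
  forall eps : R, 0 < eps -> \forall n \near \oo, forall x, K x -> `|f x - F n x| < eps.
Proof.
split=> [cvgF eps eps0|h P /uniform_nbhs[E [entE EP]]].
  suff nbf : nbhs (f : {uniform` K -> 'rV[R]_m})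
      [set h : U -> 'rV[R]_m | forall x, K x -> `|f x - h x| < eps].
    exact: (cvgF _ nbf).
  apply/uniform_nbhs.
  exists [set xy : 'rV[R]_m * 'rV[R]_m | ball xy.1 eps xy.2]; split.
    by rewrite -entourage_ballE; exists eps.
  by move=> g h x Kx; have := h x Kx; rewrite /= -ball_normE.
move: entE; rewrite -entourage_ballE => -[eps eps0 epsE].
have := h eps eps0; apply: filterS => n hn; apply: EP => x Kx; apply: epsE.
by rewrite /= -ball_normE; exact: hn.
Qed.

Unset Implicit Arguments.

Theorem theorem4p1 (R : realType) (d m : nat) (hd : (1 <= d)%N) (hm : (2 <= m)%N)
    (I : set R) (hI : right_halfline I)
    (alpha : R) (halpha : 0 < alpha < 1)
    (A : coeffs R d m)
    (h_i : cond_i alpha I A) (h_ii : cond_ii I A) (h_iii : cond_iii I A)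
    (h_iv : cond_iv I A) (h_v : cond_v I A)
    (s T : R) (hs : I s) (hT : I T) (hsT : s < T)
    (r : 'I_m -> R -> 'rV[R]_d -> R)
    (h_a : coeffs_Cn_holder_loc 3 alpha I A)
    (h_b : cond_b s T A r) (h_c : cond_c s T A)
    (h_d : cond_d s T A r) (h_e : cond_e s T A)
    (S : R -> R -> ('rV[R]_d -> 'rV[R]_m) -> 'rV[R]_d -> 'rV[R]_m)
    (hS : frozen_semigroups I A S)
    (f : 'rV[R]_d -> 'rV[R]_m) (hf : Cb f) :
  let D := [set p : R * R * 'rV[R]_d | I p.1.1 /\ 0 < p.1.2] in
  {within D, continuous (fun p : R * R * 'rV[R]_d => S p.1.1 p.1.2 f p.2)} /\
  (forall fn : nat -> 'rV[R]_d -> 'rV[R]_m,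
     (forall n, Cb (fn n)) ->
     (exists M : R, forall n x, enorm (fn n x) <= M) ->
     locally_uniform_cvg [set: 'rV[R]_d] fn f ->
     locally_uniform_cvg D
       (fun n (p : R * R * 'rV[R]_d) => S p.1.1 p.1.2 (fn n) p.2)
       (fun p : R * R * 'rV[R]_d => S p.1.1 p.1.2 f p.2)).
Proof.
move=> D; case/andP: halpha => alpha0 _.
have sol t g : I t -> Cb g -> bounded_classical_solution A t g (fun tau => S t tau g).
  by move=> It Cg; have [] := hS t g It Cg.
have row_le (y : 'rV[R]_m) (eps : R) : 0 < eps -> (forall k, `|y 0 k| <= eps / 2) -> `|y| < eps.
  move=> eps0 hy; apply: le_lt_trans (_ : eps / 2 < eps); last by lra.
  by apply/rV_norm_leP => //; rewrite divr_ge0 // ltW.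
split.
  apply/within_continuousP => -[[t0 tau0] x0] [/= It0 tau00] eps eps0.
  have eps4 : 0 < eps / 2 by rewrite divr_gt0.
  have u0 := sol t0 f It0 hf.
  have [eta eta0 close] := frozen_time_continuity hI alpha0 h_i h_ii h_iii h_v It0 hf u0
    (addr_ge0 (ltW tau00) ler01) (addr_ge0 (normr_ge0 x0) ler01) (divr_gt0 eps4 (ltr0Sn R 1)).
  have [uc _ _ _ _] := u0.
  have [del del0 hdel] := (within_continuousP _ _).1 uc (tau0, x0) (ltW tau00) _ eps4.
  exists (Num.min (Num.min eta del) 1); first by rewrite !lt_min eta0 del0 ltr01.
  move=> [[t tau] x] [/= It tau_gt0] dist.
  have [d1 d2 d3] : [/\ `|t0 - t| < Num.min (Num.min eta del) 1,
      `|tau0 - tau| < Num.min (Num.min eta del) 1 & `|x0 - x| < Num.min (Num.min eta del) 1].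
    move: dist; rewrite prod_normE /= gt_max prod_normE /= gt_max.
    by move=> /andP[/andP[-> ->] ->].
  move: d1 d2 d3; rewrite !lt_min => /andP[/andP[d1 _] _] /andP[/andP[_ d2] d2'].
  move=> /andP[/andP[_ d3] d3'].
  rewrite -[S t0 tau0 f x0](subrK (S t0 tau f x)) -addrA.
  apply: le_lt_trans (ler_normD _ _) _.
  rewrite [ltRHS](_ : _ = eps / 2 + eps / 2); last by lra.
  apply: ltr_leD.
    by apply: (hdel (tau, x)); [exact: ltW|rewrite prod_normE /= gt_max d2 d3].
  apply/rV_norm_leP => [|k]; first exact: ltW.
  rewrite !mxE distrC; apply: le_trans (_ : eps / 2 / 2 <= _); last by lra.
  apply: (close t _ It _ (sol t f It hf)); first by rewrite distrC.
    rewrite (ltW tau_gt0) /=; move: d2'; rewrite ltr_norml => /andP[]; lra.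
  rewrite -(subrK x0 x) addrC; apply: le_trans (ler_normD _ _) _.
  by rewrite lerD2l distrC ltW.
move=> fn Cfn [M fnM] fnf K cK KD.
apply/uniform_cvg_dist => eps eps0.
have [N [_ hN]] := compact_bounded cK.
pose N1 := `|N + 1|.
have K_le p : K p -> [/\ `|p.1.1| <= N1, `|p.1.2| <= N1 & `|p.2| <= N1].
  move=> Kp; have : `|p| <= N + 1 by apply: hN => //; rewrite ltrDl.
  move=> /le_trans/(_ (ler_norm _)); rewrite -/N1 prod_normE /= ge_max prod_normE /= ge_max.
  by move=> /andP[/andP[-> ->] ->].
have [F F0 fF] := Cb_bound hf.
have FM0 : 0 <= F + `|M| by rewrite addr_ge0.
have [rho [del [del0 stab]]] := initial_data_stability h_i h_ii h_iii h_v
  (right_halfline_bounded N1 hI) FM0 (normr_ge0 (N + 1)) (normr_ge0 (N + 1))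
  (divr_gt0 eps0 (ltr0Sn R 1)).
have := (uniform_cvg_dist _ _ _).1
  (fnf _ (@compact_ball R d 0 rho) (@subsetT _ _)) del del0.
move=> fnear; apply: filterS fnear => n fn_close [[t tau] x] Kp.
have [/= It tau0] := KD _ Kp; have [/= tN tauN xN] := K_le _ Kp.
apply: (row_le (S t tau f x - S t tau (fn n) x)) => // k; rewrite !mxE.
apply: (stab t f (fn n) (fun sigma => S t sigma f) (fun sigma => S t sigma (fn n))) => //=.
- exact: sol.
- exact: sol.
- by move=> y l; apply: le_trans (fF y l) _; rewrite lerDl.
- move=> y l; apply: le_trans (rV_norm_coord _ _) _; apply: le_trans (norm_le_enorm _) _.
  by apply: le_trans (fnM n y) _; apply: le_trans (ler_norm _) _; rewrite lerDr.
- move=> y l yr; have := fn_close y; rewrite /= subr0 => /(_ yr) /ltW h.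
  have -> : f y 0 l - fn n y 0 l = (f y - fn n y) 0 l by rewrite !mxE.
  exact: le_trans (rV_norm_coord _ _) h.
- by rewrite (ltW tau0) (le_trans (ler_norm _) tauN).
Qed.
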